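(* Let $d\ge 1$ be an integer, $s\in(0,1)$, and let $h:\mathbb{Z}^d\to\mathbb{R}$ satisfy: (h1) there exists $h_0\in(-1,0)$ with $\inf_{x\in\mathbb{Z}^d}h(x)\ge h_0$; (h3) there is $x_0\in\mathbb{Z}^d$ with $h(x)\to+\infty$ as $|x-x_0|\to+\infty$. Then the equation $(-\Delta)^s u+h(x)u=u\log u^2$ on $\mathbb{Z}^d$ has a ground state sign-changing solution, i.e. there is a weak solution $u\in D(J)$ with $u^+\neq0$, $u^-\ne0$ and $J(u)=m$, where $m=\inf_{v\in\mathcal{M}}J(v)$.
   Context: Setting: $|x-y|=\sum_{i=1}^d|x_i-y_i|$ is the graph distance on the lattice graph $\mathbb{Z}^d$. Integrals over $\mathbb{Z}^d$ are with respect to counting measure $\mu$ (i.e. sums). Convention: $0\log 0=0$ (so $t\log t^2=t^2\log t^2=0$ at $t=0$). $u^+=\max\{u,0\}$, $u^-=\min\{u,0\}$. Fractional Laplacian: $(-\Delta)^su(x)=\sum_{y\ne x}w_s(x,y)(u(x)-u(y))$ for $u\in\ell^\infty(\mathbb{Z}^d)$, where $w_s$ is a symmetric positive function such that, for constants $c_{s,d},C_{s,d}>0$, $c_{s,d}|x-y|^{-d-2s}\le w_s(x,y)\le C_{s,d}|x-y|^{-d-2s}$ for all $x\neq y$. Fractional gradient: $\nabla^su\nabla^sv(x)=\frac12\sum_{y\ne x}w_s(x,y)(u(x)-u(y))(v(x)-v(y))$, $|\nabla^su(x)|^2=\nabla^su\nabla^su(x)$. Spaces: $W^{s,2}(\mathbb{Z}^d)=\{u\in\ell^\infty(\mathbb{Z}^d):\int(|\nabla^su|^2+u^2)\,d\mu<\infty\}$;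 $\mathcal{H}_s=\{u\in W^{s,2}(\mathbb{Z}^d):\int(h+1)u^2\,d\mu<\infty\}$ with norm $\|u\|_{\mathcal{H}_s}^2=\int(|\nabla^su|^2+(h+1)u^2)\,d\mu$. Functional: $J(u)=\frac12\|u\|_{\mathcal{H}_s}^2-\frac12\int u^2\log u^2\,d\mu\in\mathbb{R}\cup\{+\infty\}$ for $u\in\mathcal{H}_s$; $D(J)=\{u\in\mathcal{H}_s:\int u^2|\log u^2|\,d\mu<\infty\}$. For $u,\phi\in D(J)$, $\langle J'(u),\phi\rangle=\int(\nabla^su\nabla^s\phi+hu\phi)\,d\mu-\int u\phi\log u^2\,d\mu$. A weak solution is $u\in D(J)$ with $\langle J'(u),\phi\rangle=0$ for all $\phi\in D(J)$. Sign-changing Nehari manifold: $\mathcal{M}=\{u\in D(J):u^\pm\ne0,\ \langle J'(u),u^+\rangle=\langle J'(u),u^-\rangle=0\}$. *)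

(* Defs.v *)
From HB Require Import structures.
From mathcomp Require Import all_boot all_order all_algebra.
From mathcomp Require Import all_classical all_reals all_analysis.

Set Implicit Arguments.
Unset Strict Implicit.
Unset Printing Implicit Defensive.

Import Order.TTheory GRing.Theory Num.Theory.
Import numFieldNormedType.Exports.

Local Open Scope classical_set_scope.
Local Open Scope ring_scope.

Definition Zd (d : nat) : Type := {ffun 'I_d -> int}.

HB.instance Definition _ (d : nat) := Choice.on (Zd d).
HB.instance Definition _ (d : nat) :=
  isPointed.Build (Zd d) [ffun=> 0 : int].

(* Every subset of the lattice is measurable, so that integrals against
   [counting] are sums over the lattice. *)
HB.instance Definition _ (d : nat) :=
  @isMeasurable.Build default_measure_display (Zd d)
    discrete_measurable discrete_measurable0
    discrete_measurableC discrete_measurableU.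

Definition l1dist (d : nat) (x y : Zd d) : nat :=
  (\sum_(i < d) `|x i - y i|)%N.

Section functional.
Context {R : realType} {d : nat}.
Implicit Types (w : Zd d -> Zd d -> R) (h u v phi : Zd d -> R).

(* The values on the diagonal are irrelevant: they are never summed. *)
Definition fractional_weight (s : R) w : Prop :=
  [/\ forall x y, w x y = w y x,
      forall x y, x != y -> 0 < w x y
    & exists c C : R, [/\ 0 < c, 0 < C
      & forall x y, x != y ->
          c * ((l1dist x y)%:R `^ (- (d%:R + 2 * s))) <= w x y /\
          w x y <= C * ((l1dist x y)%:R `^ (- (d%:R + 2 * s)))]].

Definition potential_bounded_below h : Prop :=
  exists2 h0 : R, -1 < h0 < 0 &
    (h0%:E <= ereal_inf [set (h x)%:E | x in [set: Zd d]])%E.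

Definition potential_coercive h : Prop :=
  exists x0 : Zd d, forall A : R, exists K : nat,
    forall x : Zd d, (K <= l1dist x x0)%N -> A <= h x.

(* The sum converges absolutely when [u] and [v] are bounded and [w] is a
   fractional weight of order [s > 0]; [gradient] is only used in this case. *)
Definition gradient w u v (x : Zd d) : R :=
  2^-1 * \int[counting]_(y in ~` [set x])
           (w x y * (u x - u y) * (v x - v y)).

Definition pos_part u : Zd d -> R := fun x => Num.max (u x) 0.

(* Nonpositive, unlike the library's [u^\-]: here u = u^+ + u^-. *)
Definition neg_part u : Zd d -> R := fun x => Num.min (u x) 0.

Definition Ws2 w : set (Zd d -> R) :=
  [set u | bounded_fun u /\
    (\int[counting]_x (gradient w u u x + u x ^+ 2)%:E < +oo)%E].

Definition Hs w h : set (Zd d -> R) :=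
  [set u | Ws2 w u /\
    (\int[counting]_x ((h x + 1) * u x ^+ 2)%:E < +oo)%E].

Definition Hs_normsq w h u : \bar R :=
  (\int[counting]_x (gradient w u u x + (h x + 1) * u x ^+ 2)%:E)%E.

(* The logarithmic term may be -oo on [Hs w h], where [J] is then +oo; its
   positive part has a finite integral there.  [ln 0] is 0 in the library, so
   the convention 0 log 0 = 0 holds. *)
Definition J w h u : \bar R :=
  ((2^-1)%:E * Hs_normsq w h u
   - (2^-1)%:E * \int[counting]_x (u x ^+ 2 * ln (u x ^+ 2))%:E)%E.

Definition DJ w h : set (Zd d -> R) :=
  [set u | Hs w h u /\
    (\int[counting]_x (u x ^+ 2 * `|ln (u x ^+ 2)|)%:E < +oo)%E].

(* Both integrands are absolutely summable for [u] and [phi] in [DJ w h]. *)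
Definition dJ w h u phi : R :=
  \int[counting]_x (gradient w u phi x + h x * u x * phi x)
  - \int[counting]_x (u x * phi x * ln (u x ^+ 2)).

(* Weak solutions of (-Delta)^s u + h u = u log u^2. *)
Definition weak_solution w h u : Prop :=
  DJ w h u /\ forall phi, DJ w h phi -> dJ w h u phi = 0.

Definition sign_changing u : Prop :=
  pos_part u <> cst 0 /\ neg_part u <> cst 0.

Definition nehari w h : set (Zd d -> R) :=
  [set u | [/\ DJ w h u, sign_changing u,
               dJ w h u (pos_part u) = 0 & dJ w h u (neg_part u) = 0]].

Definition ground_level w h : \bar R := ereal_inf [set J w h v | v in nehari w h].

End functional.

(* Main.v *)
From HB Require Import structures.
Require Import Defs.
From mathcomp Require Import all_boot all_order all_algebra.
From mathcomp Require Import all_classical all_reals all_analysis.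
From mathcomp Require Import ring lra.
From mathcomp Require finmap.

Set Implicit Arguments.
Unset Strict Implicit.
Unset Printing Implicit Defensive.

Import Order.TTheory GRing.Theory Num.Theory.
Import numFieldNormedType.Exports.

Local Open Scope classical_set_scope.
Local Open Scope ring_scope.

(** On the lattice everything reduces to absolutely convergent sums.  Write
    [E(u, v)] for the energy form, [<J'(u), v>] for [dJ w h u v], and [|u|] for
    the [l2] norm.

    The nonlinearity is special in two ways.  First,
    [2 J(u) = |u|^2 + <J'(u), u>], so that [J(u) = |u|^2 / 2] on the Nehari
    manifold.  Secondly, the scaling of [J] along [u^+] and [u^-] is explicit:
    with [p = |u^+|^2], [q = |u^-|^2], [D = <J'(u), u^+>], [D' = <J'(u), u^->] and
    [P = E(u^+, u^-) >= 0],
    [2 J(a u^+ + b u^-) = a^2 p (1 + D/p - ln a^2) + b^2 q (1 + D'/q - ln b^2)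
    - P (a - b)^2].  As [t (1 + y - ln t) <= e^y], this is at most
    [p e^(D/p) + q e^(D'/q)].  Some combination with [a, b > 0] lies on the
    manifold ([nehari_scalings]), whence, for the level [m] and for every
    sign-changing [u] in the domain ([ground_level_le]),

      [2 m <= p e^(D/p) + q e^(D'/q)].

    Existence.  A minimizing sequence is bounded, so it converges pointwise along
    an ultrafilter to some [u].  All terms of [<J'(u), u^+>] and [<J'(u), u^->] are
    bounded below by a fixed finitely supported function, because [h] tends to
    infinity and [(u(x) - u(y)) (u^+(x) - u^+(y)) >= 0].  Fatou's lemma therefore
    gives [D, D' <= 0] and [|u|^2 <= 2 m] for the limit.  The parts of the limit do
    not vanish: [<J'(v), v^+> = 0] forces [v^+(x)^2 >= e^(h(x))] at some point [x],
    and boundedness confines [x] to a finite set.  The displayed inequality now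
    reads [2 m <= p e^(D/p) + q e^(D'/q) <= p + q <= 2 m], so [D = D' = 0] and [u]
    is a minimizer on the manifold ([nehari_minimizer]).

    Criticality.  Apply the displayed inequality to [v = u + e delta_x].  Since
    [D] and [D'] vanish at [u] they are [O(e)] at [v], and
    [p e^(D/p) = p + D + O(e^2)].  The right-hand side is then
    [2 J(v) + O(e^2) = 2 m + 2 e <J'(u), delta_x> + o(e)], and both signs of [e]
    give [<J'(u), delta_x> = 0] ([minimizer_critical_delta]).  By density of the finitely supported
    functions [<J'(u), phi> = 0] on the whole domain ([critical_of_delta]). *)

(** * Sums over the lattice *)

(** Locked: unification must compare sums by their terms, and not by unfolding
    the integral. *)
HB.lock Definition lsum {R : realType} {d : nat} (f : Zd d -> R) : R :=
  \int[@counting (Zd d) R]_x f x.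

Section lattice_sums.
Context {R : realType} {d : nat}.
Local Notation T := (Zd d).
Implicit Types (f g : T -> R) (s : seq T).

Definition summ f : Prop :=
  (@counting T R).-integrable [set: T] (EFin \o f).

Lemma lsumE f : lsum f = \int[@counting T R]_x f x.
Proof. by rewrite lsum.unlock. Qed.

Lemma summ_le f g : summ g -> (forall x, `|f x| <= g x) -> summ f.
Proof.
move=> sg fg; apply: (le_integrable _ _ _ sg) => // x _ /=.
by rewrite lee_fin (le_trans (fg x)) // ler_norm.
Qed.

Lemma summ_norm f : summ f -> summ (fun x => `|f x|).
Proof.
by move=> sf; apply: (le_integrable _ _ _ sf) => // x _ /=; rewrite normr_id.
Qed.

Lemma summ0 : summ (fun=> 0).
Proof. exact: integrable0. Qed.

Lemma summD f g : summ f -> summ g -> summ (fun x => f x + g x).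
Proof. exact: integrableD. Qed.

Lemma summB f g : summ f -> summ g -> summ (fun x => f x - g x).
Proof. exact: integrableB. Qed.

Lemma summZ c f : summ f -> summ (fun x => c * f x).
Proof. exact: integrableZl. Qed.

Lemma lsumD f g : summ f -> summ g ->
  lsum (fun x => f x + g x) = lsum f + lsum g.
Proof. by move=> sf sg; rewrite !lsumE; exact: RintegralD. Qed.

Lemma lsumB f g : summ f -> summ g ->
  lsum (fun x => f x - g x) = lsum f - lsum g.
Proof. by move=> sf sg; rewrite !lsumE; exact: RintegralB. Qed.

Lemma lsumZ c f : summ f -> lsum (fun x => c * f x) = c * lsum f.
Proof. by move=> sf; rewrite !lsumE; exact: RintegralZl. Qed.

Lemma lsum_le f g : summ f -> summ g -> (forall x, f x <= g x) ->
  lsum f <= lsum g.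
Proof. by move=> sf sg fg; rewrite !lsumE; apply: le_Rintegral. Qed.

Lemma lsum_ge0 f : (forall x, 0 <= f x) -> 0 <= lsum f.
Proof. by move=> f0; rewrite lsumE; apply: Rintegral_ge0. Qed.

Lemma norm_lsum_le f g : summ g -> (forall x, `|f x| <= g x) ->
  `|lsum f| <= lsum g.
Proof.
move=> sg fg; have sf := summ_le sg fg.
have fg' x : - g x <= f x <= g x by rewrite -ler_norml.
rewrite ler_norml -mulN1r -lsumZ//; apply/andP; split.
  apply: lsum_le => // [|x]; first exact: summZ.
  by rewrite mulN1r; have /andP[] := fg' x.
by apply: lsum_le => // x; have /andP[] := fg' x.
Qed.

Lemma lsum0 : lsum (fun _ : T => 0) = 0 :> R.
Proof. by rewrite lsumE /Rintegral integral0. Qed.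

Lemma EFin_lsum f : summ f -> (\int[counting]_x (f x)%:E)%E = (lsum f)%:E.
Proof. by move=> sf; rewrite lsumE /Rintegral fineK// integrable_fin_num. Qed.

Lemma summ_lty f : (forall x, 0 <= f x) ->
  ((\int[counting]_x (f x)%:E)%E < +oo)%E <-> summ f.
Proof.
move=> f0; split=> [lf|sf]; last by rewrite EFin_lsum// ltry.
apply/integrableP; split; first by [].
apply: le_lt_trans lf; rewrite le_eqVlt; apply/orP; left; apply/eqP.
by apply: eq_integral => x _ /=; rewrite ger0_norm.
Qed.

Let indic_lsum (x : T) :
  summ (fun y => (y == x)%:R) /\ lsum (fun y => (y == x)%:R : R) = 1.
Proof.
have E : (fun y => ((y == x)%:R : R)%:E) = (fun y => (\1_[set x] y)%:E).
  by apply/funext => y; rewrite indicE in_set1.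
have I : (\int[@counting T R]_y ((y == x)%:R)%:E = 1)%E.
  rewrite E integral_indic// setIT /= /counting asboolT; last exact: finite_set1.
  by rewrite fset_set1 finmap.cardfs1.
have S : summ (fun y => (y == x)%:R).
  by apply/summ_lty => [y|]; rewrite ?ler0n// I ltry.
by split=> //; rewrite lsumE /Rintegral I.
Qed.

Lemma seq_supportE s f : uniq s -> (forall x, x \notin s -> f x = 0) ->
  summ f /\ lsum f = \sum_(x <- s) f x.
Proof.
elim: s f => [|a s IH] f /=.
  move=> _ f0; have -> : f = fun=> 0 by apply/funext => x; rewrite f0.
  by rewrite big_nil lsum0; split=> //; exact: summ0.
move=> /andP[as_ us] f0.
pose g y := f y * (y != a)%:R.
have g0 x : x \notin s -> g x = 0.
  move=> xs; rewrite /g; case: eqVneq => [_|xa]; first by rewrite mulr0.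
  by rewrite f0 ?mul0r// inE negb_or xa.
have [sg gE] := IH g us g0; have [s1 E1] := indic_lsum a.
have -> : f = fun y => f a * (y == a)%:R + g y.
  by apply/funext => y; rewrite /g; case: eqVneq => [->|_];
    rewrite ?mulr1 ?mulr0 ?addr0 ?add0r.
split; first by apply: summD => //; exact: summZ.
rewrite lsumD//; last exact: summZ.
rewrite lsumZ// E1 mulr1 gE big_cons eqxx mulr1 /g eqxx mulr0 addr0; congr (_ + _).
apply: eq_big_seq => x xs; case: eqVneq => [xa|xa]; last by rewrite mulr0 add0r.
by rewrite -xa xs in as_.
Qed.

Lemma lsum_ge_seq f s : summ f -> (forall x, 0 <= f x) -> uniq s ->
  \sum_(x <- s) f x <= lsum f.
Proof.
move=> sf f0 us; pose g x := if x \in s then f x else 0.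
have [|sg gE] := @seq_supportE s g us; first by move=> x /negPf xs; rewrite /g xs.
have -> : \sum_(x <- s) f x = lsum g.
  by rewrite gE; apply: eq_big_seq => x xs; rewrite /g xs.
by apply: lsum_le => // x; rewrite /g; case: ifP.
Qed.

Lemma summ_le_point f x : summ f -> (forall x, 0 <= f x) -> f x <= lsum f.
Proof.
by move=> sf f0; have := @lsum_ge_seq f [:: x] sf f0 isT; rewrite big_seq1.
Qed.


(** Monotone convergence along an enumeration of the lattice. *)
Lemma summ_bound f c : (forall x, 0 <= f x) ->
  (forall s, uniq s -> \sum_(x <- s) f x <= c) -> summ f /\ lsum f <= c.
Proof.
move=> f0 fc; pose e (x : T) : nat := pickle (x : {ffun 'I_d -> int}).
(* the points among the first n of the enumeration *)
pose s n : seq T := pmap (@pickle_inv {ffun 'I_d -> int}) (iota 0 n).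
have us n : uniq (s n).
  by apply: (pmap_uniq (@pickle_invK _)); exact: iota_uniq.
have sE n x : (x \in s n) = (e x < n)%N.
  rewrite mem_pmap; apply/mapP/idP => [[k]|xn].
    rewrite mem_iota add0n => kn E; have := @pickle_invK {ffun 'I_d -> int} k.
    by rewrite -E /= /e => ->.
  by exists (e x); rewrite ?mem_iota ?add0n ?pickleK_inv.
pose g n x : \bar R := (if x \in s n then f x else 0)%:E.
have gI n : (\int[@counting T R]_x g n x <= c%:E)%E.
  have [|sg E] := @seq_supportE (s n) (fun x => if x \in s n then f x else 0) (us n).
    by move=> x /negPf->.
  rewrite (EFin_lsum sg) lee_fin E; apply: le_trans (fc _ (us n)).
  by rewrite le_eqVlt; apply/orP; left; apply/eqP; apply: eq_big_seq => x ->.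
have g0 n x : (0 <= g n x)%E by rewrite lee_fin; case: ifP.
have nd x : {homo g ^~ x : n m / (n <= m)%N >-> (n <= m)%E}.
  move=> n m nm; rewrite lee_fin !sE; case: (ltnP (e x) n) => xn; last first.
    by case: ifP => _; rewrite ?f0.
  by rewrite (leq_trans xn nm).
have lg x : limn (g ^~ x) = (f x)%:E.
  apply/cvg_lim => //; apply: cvg_near_cst.
  by exists (e x).+1 => // n /= xn; rewrite /g sE xn.
have fI : (\int[@counting T R]_x (f x)%:E <= c%:E)%E.
  under eq_integral do rewrite -lg.
  rewrite monotone_convergence//.
  apply: lime_le; last exact: nearW.
  apply: ereal_nondecreasing_is_cvgn => n m nm.
  by apply: ge0_le_integral => // x _; exact: nd.
have sf : summ f by apply/summ_lty => //; rewrite (le_lt_trans fI)// ltry.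
by split=> //; rewrite -lee_fin -EFin_lsum.
Qed.

Lemma lsum_sum (I : Type) (r : seq I) (F : I -> T -> R) :
  (forall i, summ (F i)) ->
  summ (fun x => \sum_(i <- r) F i x) /\
  lsum (fun x => \sum_(i <- r) F i x) = \sum_(i <- r) lsum (F i).
Proof.
move=> sF; elim: r => [|i r [sr IH]].
  rewrite big_nil -[RHS]lsum0.
  have -> : (fun x => \sum_(i <- [::]) F i x) = fun=> 0.
    by apply/funext => x; rewrite big_nil.
  by split=> //; exact: summ0.
have -> : (fun x => \sum_(j <- i :: r) F j x) =
    fun x => F i x + \sum_(j <- r) F j x.
  by apply/funext => x; rewrite big_cons.
by rewrite big_cons -IH; split; [exact: summD | exact: lsumD].
Qed.

(** One half of Tonelli's theorem: a finite sum over [x] of the sums over [y] is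
    the sum over [y] of finite sums over [x]. *)
Lemma lsum_exchange (a : T -> T -> R) :
  (forall x y, 0 <= a x y) -> (forall x, summ (a x)) ->
  (forall y, summ (a ^~ y)) -> summ (fun y => lsum (a ^~ y)) ->
  summ (fun x => lsum (a x)) /\
  lsum (fun x => lsum (a x)) <= lsum (fun y => lsum (a ^~ y)).
Proof.
move=> a0 sa sa' saa; apply: summ_bound => [x|s us]; first exact: lsum_ge0.
have [sF <-] := lsum_sum s sa; apply: lsum_le => // y.
exact: lsum_ge_seq.
Qed.

Lemma near_sum_ge (I : Type) (U : set_system I) (FU : ProperFilter U)
    (F : I -> T -> R) f s e :
  (forall x e, 0 < e -> \forall i \near U, f x - e <= F i x) -> 0 < e ->
  \forall i \near U, \sum_(x <- s) f x - e <= \sum_(x <- s) F i x.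
Proof.
move=> lF; elim: s e => [|x s IH] e e0.
  by apply: nearW => i; rewrite !big_nil sub0r oppr_le0 ltW.
near=> i; rewrite !big_cons [e]splitr opprD addrACA lerD//.
  by near: i; apply: lF; rewrite divr_gt0.
by near: i; apply: IH; rewrite divr_gt0.
Unshelve. all: by end_near. Qed.

(** A sum is the supremum of its finite partial sums, so Fatou's lemma holds
    along any filter.  It is applied along an ultrafilter. *)
Lemma fatou_ge0 (I : Type) (U : set_system I) (FU : ProperFilter U)
    (F : I -> T -> R) f c :
  (forall x, 0 <= f x) ->
  (\forall i \near U, [/\ summ (F i), forall x, 0 <= F i x & lsum (F i) <= c]) ->
  (forall x e, 0 < e -> \forall i \near U, f x - e <= F i x) ->
  summ f /\ lsum f <= c.
Proof.
move=> f0 nF lF; apply: summ_bound => // s us; apply/ler_addgt0Pr => e e0.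
have [i [[sF F0 Fc] iS]] := @filter_ex _ _ FU _ (filterI nF (near_sum_ge FU s lF e0)).
rewrite -lerBlDr (le_trans iS)// (le_trans _ Fc)//; exact: lsum_ge_seq.
Qed.

Lemma lsum_approx f e : summ f -> (forall x, 0 <= f x) -> 0 < e ->
  exists2 s, uniq s & lsum f - e <= \sum_(x <- s) f x.
Proof.
move=> sf f0 e0; apply: contrapT => H.
suff [_] : summ f /\ lsum f <= lsum f - e by rewrite lerDl oppr_ge0 leNgt e0.
apply: summ_bound => // s us; rewrite leNgt; apply/negP => /ltW h.
by apply: H; exists s.
Qed.

Lemma liminf_lsum (I : Type) (U : set_system I) (FU : ProperFilter U)
    (F : I -> T -> R) f e :
  (forall i, summ (F i)) -> (forall i x, 0 <= F i x) ->
  summ f -> (forall x, 0 <= f x) ->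
  (forall x e, 0 < e -> \forall i \near U, f x - e <= F i x) -> 0 < e ->
  \forall i \near U, lsum f - e <= lsum (F i).
Proof.
move=> sF F0 sf f0 lF e0; have e20 : 0 < e / 2 by rewrite divr_gt0.
have [s us fs] := lsum_approx sf f0 e20.
apply: filterS (near_sum_ge FU s lF e20) => i h.
have := @lsum_ge_seq (F i) s (sF i) (F0 i) us; apply: le_trans.
apply: le_trans h; move: fs; set A := lsum f; set B := \sum_(x <- s) _; lra.
Qed.

(** Signed terms are allowed as long as they have a common summable minorant. *)
Lemma fatou_minorant (I : Type) (U : set_system I) (FU : ProperFilter U)
    (F : I -> T -> R) f g c :
  summ f -> summ g -> (forall x, - g x <= f x) ->
  (\forall i \near U, [/\ summ (F i), forall x, - g x <= F i x & lsum (F i) <= c]) ->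
  (forall x e, 0 < e -> \forall i \near U, f x - e <= F i x) ->
  lsum f <= c.
Proof.
move=> sf sg gf nF lF.
have [x|||_] := @fatou_ge0 _ _ FU (fun i x => F i x + g x) (fun x => f x + g x)
  (c + lsum g).
- by rewrite -(opprK (g x)) subr_ge0.
- near=> i; have [sF gF Fc] :
    [/\ summ (F i), forall x, - g x <= F i x & lsum (F i) <= c].
    by near: i.
  split; first exact: summD.
    by move=> x; rewrite -(opprK (g x)) subr_ge0.
  by rewrite lsumD// lerD2r.
- move=> x e e0; apply: filterS (lF x e e0) => i; lra.
by rewrite lsumD// lerD2r.
Unshelve. all: by end_near. Qed.
End lattice_sums.

(** * The logarithmic nonlinearity *)

Section xlog.
Context {R : realType}.
Implicit Types a b e r s t : R.

Definition xlog t : R := t ^+ 2 * ln (t ^+ 2).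

Lemma xlog0 : xlog 0 = 0.
Proof. by rewrite /xlog expr0n mul0r. Qed.

Lemma xlogM a t : xlog (a * t) = a ^+ 2 * xlog t + t ^+ 2 * xlog a.
Proof.
rewrite /xlog exprMn.
have [->|a0] := eqVneq a 0; first by rewrite expr0n /=; ring.
have [->|t0] := eqVneq t 0; first by rewrite expr0n /=; ring.
by rewrite lnM ?posrE ?exprn_even_gt0//; ring.
Qed.

Lemma norm_xlog t : `|xlog t| = t ^+ 2 * `|ln (t ^+ 2)|.
Proof. by rewrite /xlog normrM ger0_norm// sqr_ge0. Qed.

Lemma ln_sqr t : t != 0 -> ln (t ^+ 2) = 2 * ln `|t|.
Proof.
by move=> t0; rewrite -real_normK ?num_real// lnXn ?normr_gt0// mulr_natl.
Qed.

Lemma ln_le_sub1 t : 0 < t -> ln t <= t - 1.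
Proof.
move=> t0; rewrite {1}(_ : t = 1 + (t - 1)); last by ring.
by apply: le_ln1Dx; lra.
Qed.

(** Where the logarithm is positive it is at most [ln b]. *)
Lemma norm_xlog_le b t : t ^+ 2 <= b ->
  `|xlog t| <= - xlog t + 2 * `|ln b| * t ^+ 2.
Proof.
move=> tb; rewrite norm_xlog /xlog.
have t2 := sqr_ge0 t.
have [t0|/ltW t1] := leP (t ^+ 2) 1.
  rewrite ler0_norm ?ln_le0// mulrN lerDl.
  by rewrite mulr_ge0// mulr_ge0.
have l1 := ln_ge0 t1.
have lb : ln (t ^+ 2) <= `|ln b|.
  apply: le_trans (ler_norm _).
  by rewrite ler_ln ?posrE// (lt_le_trans ltr01)// (le_trans t1).
rewrite ger0_norm//.
have := ler_wpM2l t2 lb; set p := t ^+ 2 * ln _; set q := t ^+ 2 * `|_|.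
by move=> pq; rewrite (_ : 2 * _ * _ = 2 * q); [lra | rewrite /q; ring].
Qed.

(** If [|t| < |s|] then [ln t^2] differs from [ln s^2] by
    [2 ln (|s| / |t|) <= 2 |s| / |t|]. *)
Lemma xlog_cross t s :
  `|t * s * ln (t ^+ 2)| <= `|xlog t| + `|xlog s| + 2 * s ^+ 2.
Proof.
have s2 := sqr_ge0 s.
have [->|t0] := eqVneq t 0; first by rewrite !mul0r normr0 !addr_ge0// mulr_ge0.
have x0 : 0 < `|t| by rewrite normr_gt0.
have [st|ts] := leP `|s| `|t|.
  apply: (@le_trans _ _ `|xlog t|); last first.
    by rewrite -addrA lerDl addr_ge0// mulr_ge0.
  rewrite norm_xlog normrM ler_wpM2r// normrM -[X in _ <= X]real_normK ?num_real//.
  by rewrite expr2 ler_wpM2l.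
have y0 : 0 < `|s| by apply: lt_trans ts.
have s0 : s != 0 by rewrite -normr_gt0.
have lE : ln (t ^+ 2) = ln (s ^+ 2) - 2 * ln (`|s| / `|t|).
  by rewrite ln_div ?posrE// !ln_sqr//; ring.
have l0 : 0 <= ln (`|s| / `|t|) by apply: ln_ge0; rewrite ler_pdivlMr// mul1r ltW.
have l1 : ln (`|s| / `|t|) <= `|s| / `|t| by apply/ltW/ln_sublinear; rewrite divr_gt0.
have n2 : `|t| * `|s| <= s ^+ 2.
  by rewrite -[X in _ <= X]real_normK ?num_real// expr2 ler_wpM2r// ltW.
rewrite (normrM (t * s)) (normrM t) lE.
apply: (@le_trans _ _ (`|t| * `|s| * (`|ln (s ^+ 2)| + 2 * (`|s| / `|t|)))).
  rewrite ler_wpM2l ?mulr_ge0// (le_trans (ler_normB _ _))// lerD2l.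
  by rewrite ger0_norm ?mulr_ge0// ler_pM2l.
rewrite mulrDr (norm_xlog s) -[X in _ <= X]addrA.
rewrite -[X in X <= _]add0r lerD// lerD//; first by rewrite ler_wpM2r.
rewrite le_eqVlt; apply/orP; left; apply/eqP.
by rewrite -[in RHS](real_normK (num_real s)); field; rewrite gt_eqF.
Qed.

(** The derivative of [xlog] at [t] is [2 t ln t^2 + 2 t].  The rate of the
    remainder is [r^2] for [t != 0]; at [t = 0] the remainder is [r^2 ln r^2]
    and [-ln |r| <= 2 |r|^(-1/2)].  Both are [O(|r|^(3/2))]. *)
Lemma xlog_expansion t : exists2 C, 0 <= C & forall r, `|r| <= 1 ->
  `|xlog (t + r) - xlog t - r * (2 * t * ln (t ^+ 2) + 2 * t)|
     <= C * (`|r| * Num.sqrt `|r|).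
Proof.
have [->|t0] := eqVneq t 0.
  (* with q = |r|^(1/2) the remainder is 4 q^4 |ln q| <= 4 q^3 *)
  exists 4 => // r r1; rewrite add0r xlog0 mulr0 mul0r addr0 mulr0 !subr0.
  have [->|r0] := eqVneq r 0; first by rewrite xlog0 normr0 mul0r mulr0.
  set q := Num.sqrt `|r|; have n0 : 0 < `|r| by rewrite normr_gt0.
  have q0 : 0 < q by rewrite sqrtr_gt0.
  have q2 : `|r| = q ^+ 2 by rewrite sqr_sqrtr// ltW.
  have q1 : q <= 1 by rewrite /q -sqrtr1 ler_sqrt.
  rewrite norm_xlog ln_sqr// -[X in X * _](real_normK (num_real r)) q2 lnXn//.
  have l0 : ln q <= 0 by exact: ln_le0.
  have l1 : - ln q <= q^-1 by
    rewrite -lnV ?posrE//; apply/ltW/ln_sublinear; rewrite invr_gt0.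
  rewrite normrM ger0_norm// ler0_norm; last by rewrite mulrn_wle0.
  have -> : (q ^+ 2) ^+ 2 * (2 * - (ln q *+ 2)) = 4 * q ^+ 4 * (- ln q).
    by ring.
  apply: (@le_trans _ _ (4 * q ^+ 4 * q^-1)).
    by rewrite ler_pM2l// mulr_gt0// exprn_gt0.
  rewrite le_eqVlt; apply/orP; left; apply/eqP; field; exact: lt0r_neq0.
set l := ln (t ^+ 2).
have s0 : 0 < t ^+ 2 by rewrite exprn_even_gt0.
exists (`|1 + l| + (2 * `|t| + 1) ^+ 2 / t ^+ 2).
  by rewrite addr_ge0// divr_ge0// sqr_ge0.
move=> r r1.
have rr : r ^+ 2 <= `|r| * Num.sqrt `|r|.
  rewrite -[X in X <= _](real_normK (num_real r)) expr2 ler_wpM2l//.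
  rewrite -{1}[`|r|]sqr_sqrtr// expr2 ler_piMl ?sqrtr_ge0//.
  by rewrite -sqrtr1 ler_sqrt.
apply: le_trans (_ : _ <= (`|1 + l| + (2 * `|t| + 1) ^+ 2 / t ^+ 2) * r ^+ 2) _;
  last first.
  by rewrite ler_wpM2l// addr_ge0// divr_ge0// sqr_ge0.
pose s := (t + r) ^+ 2.
(* the remainder of s ln s at s0 = t^2 lies between 0 and (s - s0)^2 / s0 *)
have [D0 D1] : 0 <= xlog (t + r) - xlog t - (1 + l) * (s - t ^+ 2) /\
    xlog (t + r) - xlog t - (1 + l) * (s - t ^+ 2) <= (s - t ^+ 2) ^+ 2 / t ^+ 2.
  have [tr|tr] := eqVneq (t + r) 0.
    rewrite /s tr xlog0 expr0n /= /xlog -/l; split.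
      have -> : 0 - t ^+ 2 * l - (1 + l) * (0 - t ^+ 2) = t ^+ 2 by ring.
      exact: ltW.
    have -> : 0 - t ^+ 2 * l - (1 + l) * (0 - t ^+ 2) = t ^+ 2 by ring.
    rewrite le_eqVlt; apply/orP; left; apply/eqP; field; exact: t0.
  have p0 : 0 < s by rewrite exprn_even_gt0.
  have E : xlog (t + r) - xlog t - (1 + l) * (s - t ^+ 2) =
      s * ln (s / t ^+ 2) - (s - t ^+ 2).
    by rewrite ln_div ?posrE// /xlog -/l -/s; ring.
  rewrite E; split.
    have : ln (t ^+ 2 / s) <= t ^+ 2 / s - 1 by rewrite ln_le_sub1// divr_gt0.
    have -> : ln (t ^+ 2 / s) = - ln (s / t ^+ 2).
      by rewrite -lnV ?posrE ?divr_gt0// invf_div.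
    move=> /(ler_wpM2l (ltW p0)).
    have -> : s * (t ^+ 2 / s - 1) = t ^+ 2 - s by field; rewrite gt_eqF.
    by rewrite mulrN; set A := s * ln _; lra.
  have : ln (s / t ^+ 2) <= s / t ^+ 2 - 1 by rewrite ln_le_sub1// divr_gt0.
  move=> /(ler_wpM2l (ltW p0)) h.
  rewrite lerBlDr (le_trans h)// le_eqVlt; apply/orP; left; apply/eqP.
  by field.
have sE : s - t ^+ 2 = r * (2 * t + r) by rewrite /s; ring.
have -> : xlog (t + r) - xlog t - r * (2 * t * l + 2 * t) =
    (1 + l) * r ^+ 2 + (xlog (t + r) - xlog t - (1 + l) * (s - t ^+ 2)).
  by rewrite sE; ring.
rewrite [X in _ <= X]mulrDl (le_trans (ler_normD _ _))// lerD//.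
  by rewrite normrM (ger0_norm (sqr_ge0 r)).
rewrite ger0_norm// (le_trans D1)// sE exprMn -[X in X <= _]mulrA.
rewrite (mulrC (r ^+ 2)) ler_wpM2r ?sqr_ge0// ler_pM2r ?invr_gt0//.
rewrite -[X in X <= _]real_normK ?num_real// lerXn2r ?nnegrE ?addr_ge0 ?mulr_ge0//.
by rewrite (le_trans (ler_normD _ _))// lerD// normrM ger0_norm.
Qed.

Lemma sqrt_norm_le1 r : `|r| <= 1 -> Num.sqrt `|r| <= 1.
Proof. by move=> r1; rewrite -[X in _ <= X]sqrtr1 ler_sqrt. Qed.

Lemma xlog_lipschitz t : exists2 K, 0 <= K & forall r, `|r| <= 1 ->
  `|xlog (t + r) - xlog t| <= K * `|r|.
Proof.
have [C C0 HC] := xlog_expansion t.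
set l := 2 * t * ln (t ^+ 2) + 2 * t in HC.
exists (C + `|l|); first by rewrite addr_ge0.
move=> r r1; rewrite -[X in `|X|](subrK (r * l)).
rewrite (le_trans (ler_normD _ _))// mulrDl lerD//; last by rewrite normrM mulrC.
rewrite (le_trans (HC _ r1))// ler_wpM2l// ler_piMr// sqrt_norm_le1//.
Qed.

Lemma continuous_xlog : continuous xlog.
Proof.
move=> t; have [K K0 HK] := xlog_lipschitz t.
apply/cvgrPdist_le => e e0; near=> u.
have ut : `|u - t| <= 1.
  near: u; have := @cvg_id _ (nbhs t) => /cvgrPdist_le/(_ 1 ltr01).
  by apply: filterS => u; rewrite distrC.
have h := HK _ ut; rewrite addrCA subrr addr0 in h.
rewrite distrC (le_trans h)//.
rewrite (@le_trans _ _ ((K + 1) * `|u - t|)) ?ler_wpM2r ?lerDl//.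
rewrite -ler_pdivlMl ?ltr_wpDl//.
near: u; have e1 : 0 < (K + 1)^-1 * e by rewrite mulr_gt0// invr_gt0 ltr_wpDl.
have := @cvg_id _ (nbhs t) => /cvgrPdist_le/(_ _ e1).
by apply: filterS => u; rewrite distrC.
Unshelve. all: by end_near. Qed.

End xlog.

(** * The energy form *)

(** The bilinear form of the fractional Laplacian, locked like [lsum]. *)
HB.lock Definition energy {R : realType} {d : nat} (w : Zd d -> Zd d -> R)
  (u v : Zd d -> R) : R := lsum (gradient w u v).

Section energy.
Context {R : realType} {d : nat}.
Local Notation T := (Zd d).
Implicit Types (u v : T -> R) (x y : T).

Local Notation l2 u := (summ (fun x => u x ^+ 2)).

Lemma sqrD_le2 (a b : R) : (a + b) ^+ 2 <= 2 * a ^+ 2 + 2 * b ^+ 2.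
Proof. by have := sqr_ge0 (a - b); rewrite !expr2; nra. Qed.

Lemma norm_mul_le (a b : R) : `|a * b| <= a ^+ 2 + b ^+ 2.
Proof. by rewrite ler_norml; apply/andP; split; rewrite !expr2; nra. Qed.

Lemma l2_le u v : l2 v -> (forall x, `|u x| <= `|v x|) -> l2 u.
Proof.
move=> sv uv; apply: summ_le sv _ => x /=.
rewrite ger0_norm ?sqr_ge0// -(real_normK (num_real (u x))).
by rewrite -(real_normK (num_real (v x))) lerXn2r ?nnegrE.
Qed.

Lemma l2_lin a b u v : l2 u -> l2 v -> l2 (fun x => a * u x + b * v x).
Proof.
move=> su sv.
apply: summ_le (summD (summZ (2 * a ^+ 2) su) (summZ (2 * b ^+ 2) sv)) _ => x /=.
rewrite ger0_norm ?sqr_ge0//.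
by have := sqrD_le2 (a * u x) (b * v x); rewrite !exprMn; lra.
Qed.

Lemma l2_sqr_le u x : l2 u -> u x ^+ 2 <= lsum (fun x => u x ^+ 2).
Proof. by move=> su; apply: (summ_le_point x su) => y; rewrite sqr_ge0. Qed.

(** The increments of functions vanish on the diagonal, so with this kernel the
    integral in [gradient] becomes a sum over the whole lattice. *)
Definition offdiag (w : T -> T -> R) x y : R := if x == y then 0 else w x y.

(** The decay of a fractional weight matters only through this bound. *)
Definition bounded_weight (w : T -> T -> R) (W : R) : Prop :=
  [/\ forall x y, w x y = w y x, forall x y, x != y -> 0 < w x y
    & forall x, summ (offdiag w x) /\ lsum (offdiag w x) <= W].

Lemma energyE w u v : energy w u v = lsum (gradient w u v).
Proof. by rewrite energy.unlock. Qed.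

Lemma gradientE w u v x : gradient w u v x = 
  2^-1 * lsum (fun y => offdiag w x y * ((u x - u y) * (v x - v y))).
Proof.
rewrite lsumE /gradient; congr (_ * _); rewrite Rintegral_mkcond.
apply: eq_Rintegral => y _; rewrite patchE /offdiag.
case: ifPn => [|]; rewrite ?inE ?notin_setE /=.
  by move=> /eqP/negPf yx; rewrite eq_sym yx mulrA.
by move=> /contrapT ->; rewrite eqxx mul0r.
Qed.

Context (w : T -> T -> R) (W : R) (hw : bounded_weight w W).

Local Notation k := (offdiag w).
Local Notation incr u v x := (fun y => k x y * ((u x - u y) * (v x - v y))).

Lemma offdiag_ge0 x y : 0 <= k x y.
Proof.
by rewrite /offdiag; case: eqVneq => // xy; case: hw => _ /(_ x y xy)/ltW.
Qed.

Lemma offdiagC x y : k x y = k y x.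
Proof. by rewrite /offdiag eq_sym; case: hw => ->. Qed.

Lemma offdiag_summ x : summ (k x). Proof. by case: hw => _ _ /(_ x)[]. Qed.

Lemma offdiag_lsum x : lsum (k x) <= W. Proof. by case: hw => _ _ /(_ x)[]. Qed.

Lemma incr_summ u v x : l2 u -> l2 v -> summ (incr u v x).
Proof.
move=> su sv.
pose C := 2 * (2 * lsum (fun x => u x ^+ 2) + 2 * lsum (fun x => v x ^+ 2)).
apply: summ_le (summZ C (offdiag_summ x)) _ => y /=.
rewrite normrM (ger0_norm (offdiag_ge0 _ _)) mulrC ler_wpM2r ?offdiag_ge0//.
rewrite (le_trans (norm_mul_le _ _))// /C mulrDr lerD//.
  rewrite (le_trans (sqrD_le2 _ _))// sqrrN.
  by have := l2_sqr_le x su; have := l2_sqr_le y su; lra.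
rewrite (le_trans (sqrD_le2 _ _))// sqrrN.
by have := l2_sqr_le x sv; have := l2_sqr_le y sv; lra.
Qed.

Lemma gradientC u v x : gradient w u v x = gradient w v u x.
Proof.
rewrite !gradientE; congr (_ * lsum _); apply/funext => y.
by rewrite [X in _ * X]mulrC.
Qed.

Lemma gradient_lin a b u1 u2 v x : l2 u1 -> l2 u2 -> l2 v ->
  gradient w (fun x => a * u1 x + b * u2 x) v x =
  a * gradient w u1 v x + b * gradient w u2 v x.
Proof.
move=> s1 s2 sv; have i1 := incr_summ x s1 sv; have i2 := incr_summ x s2 sv.
rewrite !gradientE mulrCA (mulrCA b) -mulrDr; congr (_ * _).
rewrite -(lsumZ a i1) -(lsumZ b i2) -lsumD; [|exact: summZ|exact: summZ].
by congr lsum; apply/funext => y; ring.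
Qed.

Lemma gradient_ge0 u v x :
  (forall y, 0 <= (u x - u y) * (v x - v y)) -> 0 <= gradient w u v x.
Proof.
move=> uv; rewrite gradientE mulr_ge0// lsum_ge0// => y.
by rewrite mulr_ge0 ?offdiag_ge0.
Qed.

Lemma gradient_sqr_ge0 u x : 0 <= gradient w u u x.
Proof. by apply: gradient_ge0 => y; rewrite -expr2 sqr_ge0. Qed.

(** Bound [(a - b)^2] by [2 a^2 + 2 b^2] and exchange the order of summation in
    the second term. *)
Lemma energy_bound u : l2 u ->
  summ (gradient w u u) /\
  energy w u u <= 2 * W * lsum (fun x => u x ^+ 2).
Proof.
move=> su.
have k0 x y z : 0 <= k x y * u z ^+ 2.
  by rewrite mulr_ge0 ?offdiag_ge0//; exact: sqr_ge0.
have s1 x : summ (fun y => k x y * u x ^+ 2).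
  have := summZ (u x ^+ 2) (offdiag_summ x).
  by congr summ; apply/funext => y; rewrite mulrC.
have s2 x : summ (fun y => k x y * u y ^+ 2).
  apply: summ_le (summZ (lsum (fun x => u x ^+ 2)) (offdiag_summ x)) _ => y /=.
  rewrite ger0_norm// mulrC.
  by rewrite ler_wpM2r ?offdiag_ge0// l2_sqr_le.
have l1 x : lsum (fun y => k x y * u x ^+ 2) <= W * u x ^+ 2.
  have -> : (fun y => k x y * u x ^+ 2) = fun y => u x ^+ 2 * k x y.
    by apply/funext => y; rewrite mulrC.
  by rewrite (lsumZ _ (offdiag_summ x)) mulrC ler_wpM2r ?sqr_ge0 ?offdiag_lsum.
have sW : summ (fun x => W * u x ^+ 2) by exact: summZ.
have sl1 : summ (fun x => lsum (fun y => k x y * u x ^+ 2)).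
  by apply: summ_le sW _ => x /=; rewrite ger0_norm //; exact: lsum_ge0.
have s1' y : summ (fun x => k x y * u y ^+ 2).
  by have := s1 y; congr summ; apply/funext => x; rewrite offdiagC.
have eC : (fun y => lsum (fun x => k x y * u y ^+ 2)) =
    fun x => lsum (fun y => k x y * u x ^+ 2).
  by apply/funext => y; congr lsum; apply/funext => x; rewrite offdiagC.
have [|sl2 l2E] := lsum_exchange (fun x y => k0 x y y) s2 s1'; first by rewrite eC.
rewrite eC in l2E.
have gle x : gradient w u u x <=
    lsum (fun y => k x y * u x ^+ 2) + lsum (fun y => k x y * u y ^+ 2).
  rewrite -lsumD// gradientE -(lsumZ _ (incr_summ x su su)).
  apply: lsum_le => [||y]; first by apply: summZ; exact: incr_summ.
    exact: summD.
  rewrite -mulrDr mulrCA ler_wpM2l ?offdiag_ge0// -expr2.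
  by have := sqrD_le2 (u x) (- u y); rewrite sqrrN; lra.
have sg : summ (gradient w u u).
  by apply: summ_le (summD sl1 sl2) _ => x /=; rewrite ger0_norm ?gradient_sqr_ge0.
split=> //; rewrite energyE; apply: le_trans (lsum_le sg (summD sl1 sl2) gle) _.
rewrite lsumD// -mulrA mulr_natl mulr2n.
have := lsum_le sl1 sW l1; rewrite lsumZ// => h.
by rewrite lerD// (le_trans l2E).
Qed.

(** Polarization. *)
Lemma gradient_summ u v : l2 u -> l2 v -> summ (gradient w u v).
Proof.
move=> su sv; have suv := l2_lin 1 1 su sv; have suv' := l2_lin 1 (-1) su sv.
have [g1 _] := energy_bound suv; have [g2 _] := energy_bound suv'.
have := summZ (4^-1) (summB g1 g2); congr summ; apply/funext => x.
rewrite !gradient_lin// !(gradientC _ (fun x => _ + _)) !gradient_lin//.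
by rewrite (gradientC v u); field.
Qed.

Lemma energyC u v : energy w u v = energy w v u.
Proof. by rewrite !energyE; congr lsum; apply/funext => x; exact: gradientC. Qed.

Lemma energy_lin a b u1 u2 v : l2 u1 -> l2 u2 -> l2 v ->
  energy w (fun x => a * u1 x + b * u2 x) v = a * energy w u1 v + b * energy w u2 v.
Proof.
move=> s1 s2 sv; have g1 := gradient_summ s1 sv; have g2 := gradient_summ s2 sv.
rewrite !energyE -(lsumZ a g1) -(lsumZ b g2) -lsumD; [|exact: summZ|exact: summZ].
by congr lsum; apply/funext => x; exact: gradient_lin.
Qed.

Lemma energy_linr a b u v1 v2 : l2 u -> l2 v1 -> l2 v2 ->
  energy w u (fun x => a * v1 x + b * v2 x) = a * energy w u v1 + b * energy w u v2.
Proof. by move=> su s1 s2; rewrite energyC energy_lin// !(energyC u). Qed.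

Lemma energy_ge0 u : 0 <= energy w u u.
Proof. by rewrite energyE; apply: lsum_ge0 => x; exact: gradient_sqr_ge0. Qed.

(** Young's inequality for the form, from its nonnegativity at [c u - v] and
    [c u + v]. *)
Lemma energy_young c u v : l2 u -> l2 v -> 0 < c ->
  2 * c * `|energy w u v| <= c ^+ 2 * energy w u u + energy w v v.
Proof.
move=> su sv c0.
have H a : 0 <= c ^+ 2 * energy w u u + 2 * (a * c) * energy w u v +
    a ^+ 2 * energy w v v.
  have := energy_ge0 (fun x => c * u x + a * v x).
  have l : l2 (fun x => c * u x + a * v x) by exact: l2_lin.
  rewrite (energy_lin c a su sv l) (energy_linr c a su su sv).
  by rewrite (energy_linr c a sv su sv) (energyC v u); congr (_ <= _); ring.
have [e0|e0] := leP 0 (energy w u v).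
  by rewrite ger0_norm//; have := H (-1); lra.
by rewrite ltr0_norm//; have := H 1; lra.
Qed.

(** Only semicontinuity is claimed: mass of [F i] may escape to infinity, which
    the nonnegative products turn into a loss. *)
Lemma liminf_gradient (I : Type) (U : set_system I) (FU : ProperFilter U)
    (F G : I -> T -> R) u v x e :
  (forall i, l2 (F i)) -> (forall i, l2 (G i)) -> l2 u -> l2 v ->
  (forall i y, 0 <= (F i x - F i y) * (G i x - G i y)) ->
  (forall y, F i y @[i --> U] --> u y) -> (forall y, G i y @[i --> U] --> v y) ->
  0 < e -> \forall i \near U, gradient w u v x - e <= gradient w (F i) (G i) x.
Proof.
move=> sF sG su sv FG0 Fu Gv e0.
have uv0 y : 0 <= (u x - u y) * (v x - v y).
  have c : (F i x - F i y) * (G i x - G i y) @[i --> U] --> (u x - u y) * (v x - v y).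
    by apply: cvgM; apply: cvgB.
  rewrite -(cvg_lim _ c)//; apply: limr_ge; first by apply/cvg_ex; eexists; exact: c.
  exact: nearW.
have cF y : k x y * ((F i x - F i y) * (G i x - G i y)) @[i --> U] -->
    k x y * ((u x - u y) * (v x - v y)).
  by apply: cvgMr; apply: cvgM; apply: cvgB.
have : \forall i \near U, lsum (incr u v x) - e <= lsum (incr (F i) (G i) x).
  apply: (@liminf_lsum _ _ _ U FU (fun i => incr (F i) (G i) x)) => //
    [i|i y||y|y r r0].
  - exact: incr_summ.
  - by rewrite mulr_ge0 ?offdiag_ge0.
  - exact: incr_summ.
  - by rewrite mulr_ge0 ?offdiag_ge0.
  have /cvgrPdist_le/(_ r r0) := cF y; apply: filterS => i.
  by rewrite ler_norml => /andP[_]; lra.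
apply: filterS => i h; rewrite !gradientE.
set A := lsum _ in h *; set B := lsum _ in h *; lra.
Qed.

End energy.

(** * Summability of the weight *)

Section series.
Context {R : realType}.

(** After division by [(a + 1)^(-p)] this is [e^y >= 1 + y] at
    [y = p ln ((a + 1) / a)], together with [ln ((a + 1) / a) >= 1 / (a + 1)]. *)
Lemma powR_telescope (a p : R) : 0 < a -> 0 < p ->
  p * (a + 1) `^ (- (1 + p)) <= a `^ (- p) - (a + 1) `^ (- p).
Proof.
move=> a0 p0; have b0 : 0 < a + 1 by lra.
have E : a `^ (- p) = (a + 1) `^ (- p) * expR (p * ln ((a + 1) / a)).
  rewrite /powR !gt_eqF// -expRD ln_div ?posrE//; congr expR; ring.
have F : (a + 1) `^ (- (1 + p)) = (a + 1) `^ (- p) * (a + 1)^-1.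
  have -> : - (1 + p) = - p + -1 by ring.
  by rewrite powRD ?(gt_eqF b0) ?implybT// (powR_inv1 (ltW b0)).
rewrite E F -[X in _ - X]mulr1 -mulrBr mulrCA ler_pM2l ?powR_gt0//.
have h1 := expR_ge1Dx (p * ln ((a + 1) / a)).
have h2 : ln (a / (a + 1)) <= a / (a + 1) - 1 by rewrite ln_le_sub1 ?divr_gt0.
have h3 : ln (a / (a + 1)) = - ln ((a + 1) / a).
  by rewrite -invf_div lnV// posrE divr_gt0.
have h4 : a / (a + 1) - 1 = - (a + 1)^-1 by field; rewrite gt_eqF.
have h5 : (a + 1)^-1 <= ln ((a + 1) / a) by lra.
have := ler_wpM2l (ltW p0) h5; lra.
Qed.

Lemma zeta_bound (p : R) (n : nat) : 0 < p ->
  \sum_(j < n) (j.+1%:R `^ (- (1 + p))) <= 1 + p^-1.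
Proof.
move=> p0; have i0 : 0 < p^-1 by rewrite invr_gt0.
case: n => [|n]; first by rewrite big_ord0 addr_ge0// ltW.
have H : \sum_(j < n.+1) (j.+1%:R `^ (- (1 + p))) <=
    1 + p^-1 * (1 - n.+1%:R `^ (- p)) :> R.
  elim: n => [|n IH]; first by rewrite big_ord1 powR1 subrr mulr0 addr0.
  rewrite big_ord_recr /=.
  have := @powR_telescope n.+1%:R p (ltr0Sn _ _) p0.
  rewrite natr1 => /(ler_wpM2l (ltW i0)); rewrite mulKf ?gt_eqF// => h.
  by rewrite (le_trans (lerD IH h))// -addrA -mulrDr subrKA.
apply: le_trans H _; by rewrite lerD2l -[X in _ <= X]mulr1 ler_wpM2l ?ltW.
Qed.

End series.

Section boxes.
Context {d : nat} (N : nat).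
Local Notation code_type := {ffun 'I_d -> bool * 'I_N.+1}.
Implicit Types x y : Zd d.

(** Sign and absolute value of the coordinates of [y - x]; a box becomes a set
    of finite functions, over which sums of products factor. *)
Definition box_code x y : code_type :=
  [ffun i => (y i < x i, inord `|x i - y i|%N)].

Definition box_decode x (f : code_type) : Zd d :=
  [ffun i => if (f i).1 then x i - ((f i).2 : nat)%:Z else x i + ((f i).2 : nat)%:Z].

Lemma box_codeK x y : (forall i, `|x i - y i|%N <= N)%N ->
  box_decode x (box_code x y) = y.
Proof.
move=> H; apply/ffunP => i; rewrite !ffunE /= inordK ?ltnS ?H//.
case: ltP => yx; rewrite abszE.
  by rewrite gtr0_norm ?subr_gt0//; ring.
by rewrite ler0_norm ?subr_le0//; ring.
Qed.

End boxes.

Section weight.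
Context {R : realType} {d : nat}.
Local Notation T := (Zd d).

Lemma ball_finite (x0 : T) (K : nat) :
  exists s : seq T, forall x, (l1dist x x0 < K)%N -> x \in s.
Proof.
exists [seq box_decode x0 f | f : {ffun 'I_d -> bool * 'I_K.+1}] => x xK.
apply/mapP; exists (box_code K x0 x); first by rewrite mem_enum.
rewrite box_codeK// => i; apply: leq_trans (ltnW xK).
by rewrite /l1dist (bigD1 i)//= distnC leq_addr.
Qed.

Lemma l1dist_gt0 (x y : T) : x != y -> (0 < l1dist x y)%N.
Proof.
move=> xy; rewrite lt0n; apply: contra xy => /eqP H; apply/eqP/ffunP => i.
apply/eqP; rewrite -subr_eq0 -absz_eq0; move: H; rewrite /l1dist (bigD1 i)//=.
by move/eqP; rewrite addn_eq0 => /andP[].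
Qed.

(** With [n = |x - y|] each factor [1 + |x_i - y_i|] is at most [2 n], so that
    [|x - y|^(-d-2s)] is dominated by a product of one-dimensional weights. *)
Lemma power_le_prod (s : R) (x y : T) : (1 <= d)%N -> 0 < s -> x != y ->
  (l1dist x y)%:R `^ (- (d%:R + 2 * s)) <=
  2 `^ (d%:R + 2 * s) *
    \prod_(i < d) (`|x i - y i|%N.+1%:R `^ (- (1 + 2 * s / d%:R))).
Proof.
move=> d1 s0 xy; set n := l1dist x y; set q := d%:R + 2 * s.
have n0 : 0 < n%:R :> R by rewrite ltr0n l1dist_gt0.
have dn0 : d%:R != 0 :> R by rewrite pnatr_eq0 -lt0n.
have -> : n%:R `^ (- q) = 2 `^ q * (2 * n%:R) `^ (- q).
  by rewrite powRM// ?ltW// mulrA -powRD ?subrr ?powRr0 ?mul1r// pnatr_eq0 implybT.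
rewrite ler_pM2l ?powR_gt0//.
have -> : - q = - (1 + 2 * s / d%:R) * d%:R by rewrite /q; field.
rewrite powRrM powR_mulrn ?powR_ge0// -[X in _ ^+ X]card_ord -prodr_const.
apply: ler_prod => i _; rewrite powR_ge0/= !powRN lef_pV2 ?posrE ?powR_gt0//;
  last by rewrite mulr_gt0.
apply: ge0_ler_powR; rewrite ?nnegrE ?ler0n//.
  by rewrite addr_ge0// mulr_ge0 ?invr_ge0 ?ler0n// mulr_ge0// ltW.
rewrite -natrM ler_nat mul2n -addnn -addn1 leq_add ?l1dist_gt0//.
by rewrite /n /l1dist (bigD1 i)//= leq_addr.
Qed.

(** A sum over a box of a product of one-dimensional weights is the [d]-th power
    of a one-dimensional sum, which [zeta_bound] controls. *)
Lemma fractional_weight_bounded (s : R) (w : T -> T -> R) : (1 <= d)%N -> 0 < s ->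
  fractional_weight s w -> exists W, bounded_weight w W.
Proof.
move=> d1 s0 [wC w0 [c [C [_ C0 wP]]]].
pose p : R := 2 * s / d%:R.
have p0 : 0 < p by rewrite divr_gt0 ?mulr_gt0// ltr0n.
pose D := C * 2 `^ (d%:R + 2 * s).
have D0 : 0 < D by rewrite mulr_gt0// powR_gt0.
exists (D * (2 * (1 + p^-1)) ^+ d); split=> // x.
have k0 y : 0 <= offdiag w x y by rewrite /offdiag; case: eqVneq => // /w0 /ltW.
apply: summ_bound => // r ur.
pose P y : R := \prod_(i < d) (`|x i - y i|%N.+1%:R `^ (- (1 + p))).
have kP y : offdiag w x y <= D * P y.
  rewrite /offdiag; case: eqVneq => [_|xy].
    rewrite mulr_ge0//; first exact: ltW.
    by apply: prodr_ge0 => i _; exact: powR_ge0.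
  have [_ /le_trans] := wP x y xy; apply.
  by rewrite /D -mulrA ler_pM2l// power_le_prod.
apply: le_trans (ler_sum _ (fun y _ => kP y)) _; rewrite -mulr_sumr ler_pM2l//.
pose N := (\max_(y <- r) \max_(i < d) `|x i - y i|)%N.
have NP y i : y \in r -> (`|x i - y i|%N <= N)%N.
  move=> yr; apply: leq_trans (_ : (\max_(i < d) `|x i - y i|%N <= N)%N).
    exact: (leq_bigmax_cond (F := fun i => `|x i - y i|%N)).
  exact: (leq_bigmax_seq (F := fun y : T => (\max_(i < d) `|x i - y i|)%N)).
pose G (c : bool * 'I_N.+1) : R := c.2.+1%:R `^ (- (1 + p)).
have PG : \sum_(y <- r) P y =
    \sum_(f <- [seq box_code N x y | y <- r]) \prod_(i < d) G (f i).
  rewrite big_map; apply: eq_big_seq => y yr; apply: eq_bigr => i _.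
  by rewrite /G ffunE /= inordK// ltnS NP.
have uc : uniq [seq box_code N x y | y <- r].
  rewrite map_inj_in_uniq// => y z yr zr /(congr1 (box_decode x)).
  by rewrite !box_codeK// => i; exact: NP.
have G0 (f : {ffun 'I_d -> bool * 'I_N.+1}) : 0 <= \prod_(i < d) G (f i).
  by rewrite prodr_ge0// => i _; exact: powR_ge0.
rewrite PG big_uniq//=.
apply: (@le_trans _ _
  (\sum_(f : {ffun 'I_d -> bool * 'I_N.+1}) \prod_(i < d) G (f i))).
  rewrite [X in _ <= X](bigID (mem [seq box_code N x y | y <- r])) /= lerDl.
  exact: sumr_ge0.
rewrite -(bigA_distr_bigA (fun=> G)) /= prodr_const card_ord.
rewrite lerXn2r ?nnegrE//.
- by rewrite sumr_ge0// => c' _; exact: powR_ge0.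
- by rewrite mulr_ge0// addr_ge0// invr_ge0 ltW.
have -> : \sum_(c : bool * 'I_N.+1) G c = \sum_(b : bool) \sum_(j < N.+1) G (b, j).
  by rewrite pair_bigA; apply: eq_bigr => -[].
by rewrite big_bool/= mulr2n mulrDl !mul1r lerD// zeta_bound.
Qed.

End weight.

(** * The functional on its domain *)

Section functional.
Context {R : realType} {d : nat}.
Local Notation T := (Zd d).
Implicit Types (u v phi : T -> R) (x y : T).

Local Notation l2 u := (summ (fun x => u x ^+ 2)).

Context (w : T -> T -> R) (W : R) (hw : bounded_weight w W).
Context (h : T -> R) (h0 : R) (h0_gt : -1 < h0) (h_ge : forall x, h0 <= h x).

(** Summability of this nonnegative function alone characterizes the domain of
    the functional, see [DJP]. *)
Definition density u x : R := (h x + 1) * u x ^+ 2 + `|xlog (u x)|.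

Definition admissible u : Prop := summ (density u).

(** [dJ u u] is the energy of [u] plus the sum of [potential x (u x)]. *)
Definition potential x (t : R) : R := h x * t ^+ 2 - xlog t.

Lemma h1_gt0 x : 0 < h x + 1. Proof. by have := h_ge x; have := h0_gt; lra. Qed.

Lemma h01_gt0 : 0 < h0 + 1. Proof. by have := h0_gt; lra. Qed.

Lemma mass_ge0 u x : 0 <= (h x + 1) * u x ^+ 2.
Proof. by rewrite mulr_ge0 ?sqr_ge0// ltW// h1_gt0. Qed.

Lemma density_ge0 u x : 0 <= density u x.
Proof. by rewrite addr_ge0 ?mass_ge0. Qed.

Lemma sqr_le_density u x : u x ^+ 2 <= (h0 + 1)^-1 * density u x.
Proof.
have k0 := h01_gt0.
rewrite ler_pdivlMl//; apply: (@le_trans _ _ ((h x + 1) * u x ^+ 2)).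
  by rewrite ler_wpM2r ?sqr_ge0// lerD2r.
by rewrite lerDl.
Qed.

Lemma admissible_le (C : R) u v : admissible u ->
  (forall x, density v x <= C * density u x) -> admissible v.
Proof.
move=> su uv; apply: summ_le (summZ C su) _ => x.
by rewrite ger0_norm ?density_ge0.
Qed.

Lemma admissible_l2 u : admissible u -> l2 u.
Proof.
move=> su; apply: summ_le (summZ (h0 + 1)^-1 su) _ => x.
by rewrite ger0_norm ?sqr_ge0// sqr_le_density.
Qed.

Lemma admissible_mass u : admissible u -> summ (fun x => (h x + 1) * u x ^+ 2).
Proof.
move=> su; apply: summ_le su _ => x.
by rewrite ger0_norm ?mass_ge0// lerDl.
Qed.

Lemma admissible_xlog u : admissible u -> summ (fun x => xlog (u x)).
Proof. by move=> su; apply: summ_le su _ => x; rewrite lerDr mass_ge0. Qed.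

Lemma DJP u : DJ w h u <-> admissible u.
Proof.
split.
  move=> [[_ Im] Il]; have sm : summ (fun x => (h x + 1) * u x ^+ 2).
    by apply/summ_lty => // x; exact: mass_ge0.
  have sl : summ (fun x => u x ^+ 2 * `|ln (u x ^+ 2)|).
    by apply/summ_lty => // x; rewrite mulr_ge0// sqr_ge0.
  by have := summD sm sl; congr summ; apply/funext => x; rewrite /density norm_xlog.
move=> su; have s2 := admissible_l2 su.
split; [split|].
- split.
    exists (lsum (fun x => u x ^+ 2) + 1); split; first exact: num_real.
    (* |t| <= t^2 + 1 *)
    move=> M /ltW lM x _ /=; apply: le_trans lM.
    have h1 := l2_sqr_le x s2; have h2 := sqr_ge0 (`|u x| - 1).
    rewrite -(real_normK (num_real (u x))) in h1; nra.
  apply/summ_lty => [x|].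
    by rewrite addr_ge0 ?sqr_ge0// (gradient_sqr_ge0 hw).
  by apply: summD => //; exact: (gradient_summ hw).
- by apply/summ_lty => [x|]; [exact: mass_ge0 | exact: admissible_mass].
apply/summ_lty => [x|]; first by rewrite mulr_ge0// sqr_ge0.
apply: summ_le su _ => x; rewrite -norm_xlog normr_id lerDr; exact: mass_ge0.
Qed.

Lemma admissible_update u v x : admissible u -> (forall y, y != x -> v y = u y) ->
  admissible v.
Proof.
move=> su uv.
pose f y := if y == x then density v x - density u x else 0.
have [|sf _] := @seq_supportE R d [:: x] f isT.
  by move=> y; rewrite inE /f => /negPf ->.
have := summD su sf; congr summ; apply/funext => y; rewrite /f.
case: eqVneq => [->|yx]; first by rewrite addrC subrK.
by rewrite addr0 /density uv.
Qed.

Lemma admissible0 : admissible (fun=> 0).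
Proof.
have := @summ0 R d; congr summ; apply/funext => x.
by rewrite /density xlog0 normr0 expr0n mulr0 addr0.
Qed.

Lemma lsum_update (g : T -> R -> R) u v x :
  (forall y, y != x -> v y = u y) -> summ (fun y => g y (u y)) ->
  lsum (fun y => g y (v y)) = lsum (fun y => g y (u y)) + (g x (v x) - g x (u x)).
Proof.
move=> uv su.
pose f y := if y == x then g x (v x) - g x (u x) else 0.
have [|sf E] := @seq_supportE R d [:: x] f isT.
  by move=> y; rewrite inE /f => /negPf ->.
have fx : f x = g x (v x) - g x (u x) by rewrite /f eqxx.
rewrite big_seq1 fx in E; rewrite -E -lsumD//.
congr lsum; apply/funext => y; rewrite /f.
by case: eqVneq => [->|yx]; [rewrite addrC subrK | rewrite addr0 uv].
Qed.

(** The positive and the negative part of [u] are treated at once: each agrees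
    with [u] where it is nonzero, and is a nondecreasing function of [u]. *)
Definition is_part phi u : Prop :=
  (forall x, phi x = u x \/ phi x = 0) /\
  (forall x y, 0 <= (u x - u y) * (phi x - phi y)).

Lemma homo_mul_ge0 (f g : R -> R) (a b : R) : {homo f : x y / x <= y} ->
  {homo g : x y / x <= y} -> 0 <= (f a - f b) * (g a - g b).
Proof.
move=> hf hg; have [ab|/ltW ab] := leP a b.
  by rewrite mulr_le0// subr_le0; [exact: hf | exact: hg].
by rewrite mulr_ge0// subr_ge0; [exact: hf | exact: hg].
Qed.

Lemma homo_max0 : {homo (fun t : R => Num.max t 0) : x y / x <= y}.
Proof. by move=> a b ab; rewrite ge_max !le_max ab lexx orbT. Qed.

Lemma homo_min0 : {homo (fun t : R => Num.min t 0) : x y / x <= y}.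
Proof. by move=> a b ab; rewrite le_min !ge_min ab lexx orbT. Qed.

Lemma pos_part_is_part u : is_part (pos_part u) u.
Proof.
split=> [x|x y]; first by rewrite /pos_part; case: (leP (u x) 0); tauto.
exact: (homo_mul_ge0 (f := id) (u x) (u y) _ homo_max0).
Qed.

Lemma neg_part_is_part u : is_part (neg_part u) u.
Proof.
split=> [x|x y]; first by rewrite /neg_part; case: (leP (u x) 0); tauto.
exact: (homo_mul_ge0 (f := id) (u x) (u y) _ homo_min0).
Qed.

Lemma admissible_part phi u : is_part phi u -> admissible u -> admissible phi.
Proof.
move=> [pu _] su; apply: (admissible_le (C := 1) su) => x; rewrite mul1r.
rewrite {1}/density; case: (pu x) => ->; first by [].
by rewrite xlog0 normr0 expr0n mulr0 addr0 density_ge0.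
Qed.

Lemma posDneg u : u = fun x => 1 * pos_part u x + 1 * neg_part u x.
Proof.
apply/funext => x; rewrite /pos_part /neg_part !mul1r.
by case: leP; rewrite ?addr0 ?add0r.
Qed.

Lemma pos_neg_cases u x :
  (pos_part u x = u x /\ neg_part u x = 0) \/
  (pos_part u x = 0 /\ neg_part u x = u x).
Proof.
by rewrite /pos_part /neg_part; case: (leP (u x) 0); [right | left].
Qed.

Lemma density_scale c u x :
  density (fun x => c * u x) x <=
  (c ^+ 2 + `|xlog c| * (h0 + 1)^-1) * density u x.
Proof.
have k0 : 0 <= (h0 + 1)^-1 by rewrite invr_ge0 ltW// h01_gt0.
rewrite {1}/density xlogM.
have n1 := ler_normD (c ^+ 2 * xlog (u x)) (u x ^+ 2 * xlog c).
rewrite [X in _ <= X + _]normrM [X in _ <= _ + X]normrM in n1.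
rewrite (ger0_norm (sqr_ge0 c)) (ger0_norm (sqr_ge0 (u x))) in n1.
have n2 := ler_wpM2r (normr_ge0 (xlog c)) (sqr_le_density u x).
have -> : (c ^+ 2 + `|xlog c| * (h0 + 1)^-1) * density u x =
    c ^+ 2 * ((h x + 1) * u x ^+ 2) + c ^+ 2 * `|xlog (u x)| +
    (h0 + 1)^-1 * density u x * `|xlog c|.
  by rewrite /density; ring.
by rewrite exprMn mulrCA -addrA lerD2l (le_trans n1)// lerD2l.
Qed.

Lemma admissible_combo (a b : R) u : admissible u ->
  admissible (fun x => a * pos_part u x + b * neg_part u x).
Proof.
move=> su; pose K c := c ^+ 2 + `|xlog c| * (h0 + 1)^-1.
have K0 c : 0 <= K c.
  by rewrite addr_ge0 ?sqr_ge0// mulr_ge0// invr_ge0 ltW// h01_gt0.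
apply: (admissible_le (C := K a + K b) su) => x.
have Ed c v v' : v x = c * v' x -> density v x <= K c * density v' x.
  by move=> E; apply: le_trans (density_scale c v' x); rewrite /density E.
rewrite mulrDl; have := density_ge0 u x => du.
case: (pos_neg_cases u x) => -[pE nE].
  have := @Ed a (fun x => a * pos_part u x + b * neg_part u x) u.
  rewrite pE nE mulr0 addr0 => /(_ erefl) /le_trans; apply.
  by rewrite lerDl mulr_ge0.
have := @Ed b (fun x => a * pos_part u x + b * neg_part u x) u.
rewrite pE nE mulr0 add0r => /(_ erefl) /le_trans; apply.
by rewrite lerDr mulr_ge0.
Qed.

Lemma summ_potential_mul u phi : admissible u -> admissible phi ->
  summ (fun x => h x * u x * phi x).
Proof.
move=> su sp; have su2 := admissible_l2 su; have sp2 := admissible_l2 sp.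
have := summD (summD (admissible_mass su) su2) (summD (admissible_mass sp) sp2).
move=> /summ_le; apply => x /=; rewrite -mulrA normrM.
have hb : `|h x| <= h x + 2.
  by rewrite ler_norml; have := h1_gt0 x; lra.
apply: (@le_trans _ _ ((h x + 2) * (u x ^+ 2 + phi x ^+ 2))).
  by apply: ler_pM => //; exact: norm_mul_le.
by rewrite le_eqVlt; apply/orP; left; apply/eqP; ring.
Qed.

(** This is where [xlog_cross] makes the pairing of two elements of the domain
    absolutely convergent. *)
Lemma summ_log_mul u phi : admissible u -> admissible phi ->
  summ (fun x => u x * phi x * ln (u x ^+ 2)).
Proof.
move=> su sp.
have := summD (summD su sp) (summZ 2 (admissible_l2 sp)).
move=> /summ_le; apply => x /=; apply: le_trans (xlog_cross _ _) _.
rewrite lerD// lerD// /density lerDr; exact: mass_ge0.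
Qed.

Lemma dJE u phi : admissible u -> admissible phi ->
  dJ w h u phi = energy w u phi +
    lsum (fun x => h x * u x * phi x - u x * phi x * ln (u x ^+ 2)).
Proof.
move=> su sp; have sh := summ_potential_mul su sp; have sl := summ_log_mul su sp.
have sg := gradient_summ hw (admissible_l2 su) (admissible_l2 sp).
by rewrite lsumB// addrA energyE -lsumD// /dJ !lsumE.
Qed.

Lemma dJ_lin a b u phi psi : admissible u -> admissible phi -> admissible psi ->
  admissible (fun x => a * phi x + b * psi x) ->
  dJ w h u (fun x => a * phi x + b * psi x) = a * dJ w h u phi + b * dJ w h u psi.
Proof.
move=> su s1 s2 s12; rewrite !dJE//.
have q := admissible_l2 su; have q1 := admissible_l2 s1.
have q2 := admissible_l2 s2.
rewrite (energy_linr hw)// !mulrDr addrACA; congr (_ + _).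
have t1 := summB (summ_potential_mul su s1) (summ_log_mul su s1).
have t2 := summB (summ_potential_mul su s2) (summ_log_mul su s2).
rewrite -(lsumZ a t1) -(lsumZ b t2) -lsumD; [|exact: summZ|exact: summZ].
by congr lsum; apply/funext => x; ring.
Qed.

Lemma potential_summ u : admissible u -> summ (fun x => potential x (u x)).
Proof.
move=> su; have sx := admissible_xlog su.
have := summB (summB (admissible_mass su) (admissible_l2 su)) sx.
by congr summ; apply/funext => x; rewrite /potential; ring.
Qed.

Lemma dJ_part phi u : is_part phi u -> admissible u ->
  dJ w h u phi = energy w u phi + lsum (fun x => potential x (phi x)).
Proof.
move=> pu su; rewrite dJE//; last exact: (admissible_part pu).
congr (_ + lsum _); apply/funext => x; rewrite /potential /xlog.
by case: (pu.1 x) => ->; rewrite ?expr0n /=; ring.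
Qed.

Lemma is_part_refl u : is_part u u.
Proof. by split=> [x|x y]; [left | rewrite -expr2 sqr_ge0]. Qed.

(** The increments of [u] and of a part of [u] have the same sign. *)
Lemma energy_part_ge0 phi u : is_part phi u -> 0 <= energy w u phi.
Proof.
move=> [_ pu]; rewrite energyE; apply: lsum_ge0 => x.
by apply: (gradient_ge0 hw) => y; exact: pu.
Qed.

(** On the Nehari manifold the second term vanishes, which leaves half the
    squared [l2] norm. *)
Lemma JE u : admissible u ->
  J w h u = (2^-1 * (lsum (fun x => u x ^+ 2) + dJ w h u u))%:E.
Proof.
move=> su; rewrite (dJ_part (is_part_refl u) su).
have s2 := admissible_l2 su; have sm := admissible_mass su.
have sl := admissible_xlog su; have sg := gradient_summ hw s2 s2.
have EL : lsum (fun x => potential x (u x)) =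
    lsum (fun x => (h x + 1) * u x ^+ 2) - lsum (fun x => u x ^+ 2)
    - lsum (fun x => xlog (u x)).
  rewrite -lsumB// -lsumB//; last exact: summB.
  by congr lsum; apply/funext => x; rewrite /potential; ring.
rewrite /J /Hs_normsq (EFin_lsum (summD sg sm)) (EFin_lsum sl) -!EFinM -EFinB.
by congr EFin; rewrite lsumD// EL energyE; field.
Qed.

Lemma dJ_posneg u : admissible u ->
  dJ w h u u = dJ w h u (pos_part u) + dJ w h u (neg_part u).
Proof.
move=> su; have sp := admissible_part (pos_part_is_part u) su.
have sn := admissible_part (neg_part_is_part u) su.
have := @dJ_lin 1 1 u _ _ su sp sn (admissible_combo 1 1 su).
by rewrite -posDneg !mul1r.
Qed.

Lemma l2_posneg u : l2 u -> l2 (pos_part u) /\ l2 (neg_part u).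
Proof.
move=> su; split; apply: l2_le su _ => x; case: (pos_neg_cases u x) => -[p n];
  by rewrite ?p ?n ?normr0.
Qed.

Lemma lsum_posneg (a b : R) u : l2 u ->
  lsum (fun x => (a * pos_part u x + b * neg_part u x) ^+ 2) =
  a ^+ 2 * lsum (fun x => pos_part u x ^+ 2) +
  b ^+ 2 * lsum (fun x => neg_part u x ^+ 2).
Proof.
move=> /l2_posneg[sp sn].
rewrite -(lsumZ (a ^+ 2) sp) -(lsumZ (b ^+ 2) sn) -lsumD;
  [|exact: summZ|exact: summZ].
congr lsum; apply/funext => x.
by case: (pos_neg_cases u x) => -[-> ->];
  rewrite mulr0 ?addr0 ?add0r expr0n exprMn mulr0 ?addr0 ?add0r.
Qed.

End functional.

(** * Projection onto the Nehari manifold *)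

Section projection.
Context {R : realType} {d : nat}.
Local Notation T := (Zd d).
Implicit Types (u v phi : T -> R) (x y : T).

Local Notation l2 u := (summ (fun x => u x ^+ 2)).

(** Divided by [a^2] and [b^2], the two equations determine [ln a^2] and [ln b^2] from
    the ratio [b / a = e^t]; their compatibility is one equation in [t], whose
    left-hand side goes from [-oo] to [+oo]. *)
Lemma nehari_scalings (D1 D2 P p q : R) : 0 < p -> 0 < q -> 0 <= P ->
  exists a b : R, [/\ 0 < a, 0 < b,
    a ^+ 2 * (D1 - P) - p * xlog a + a * b * P = 0 &
    b ^+ 2 * (D2 - P) - q * xlog b + a * b * P = 0].
Proof.
move=> p0 q0 P0.
pose c := (D2 - P) / q - (D1 - P) / p.
pose k (t : R) : R := 2 * t - c + (P / p * expR t - P / q * expR (- t)).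
(* far enough out for the sign of k to be that of 2 t *)
pose M := `|c| + P / p + P / q.
have Pp : 0 <= P / p by rewrite divr_ge0// ltW.
have Pq : 0 <= P / q by rewrite divr_ge0// ltW.
have M0 : 0 <= M by rewrite !addr_ge0.
have ck : continuous k.
  move=> t; apply: cvgD.
    by apply: cvgB; [apply: cvgMr; exact: cvg_id | exact: cvg_cst].
  apply: cvgB; first by apply: cvgMr; exact: continuous_expR.
  apply: cvgMr; apply: (@continuous_comp _ _ _ (@GRing.opp R) expR t).
    exact: opp_continuous.
  exact: continuous_expR.
have eM : expR (- M) <= 1 by rewrite expR_le1 oppr_le0.
have cn := ler_norm c; have cn' := ler_norm (- c); rewrite normrN in cn'.
have kM : 0 <= k M.
  have e1 : 0 <= P / p * expR M by rewrite mulr_ge0// expR_ge0.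
  have e2 : P / q * expR (- M) <= P / q by rewrite ler_piMr.
  by rewrite /k; rewrite {1}/M; lra.
have kNM : k (- M) <= 0.
  have e1 : 0 <= P / q * expR M by rewrite mulr_ge0// expR_ge0.
  have e2 : P / p * expR (- M) <= P / p by rewrite ler_piMr.
  by rewrite /k opprK; rewrite {1}/M; lra.
have [t _ kt] : exists2 t, t \in `[- M, M] & k t = 0.
  apply: IVT; first by lra.
    exact: continuous_subspaceT.
  by rewrite ge_min kNM le_max kM orbT.
pose A := (D1 - P + expR t * P) / p.
pose a := expR (A / 2); pose b := a * expR t.
have a0 : 0 < a by exact: expR_gt0.
have b0 : 0 < b by rewrite mulr_gt0// expR_gt0.
have la : xlog a = a ^+ 2 * A.
  by rewrite /xlog ln_sqr ?gt_eqF// ger0_norm ?ltW// /a expRK; field.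
have lb : xlog b = b ^+ 2 * (A + 2 * t).
  rewrite /xlog ln_sqr ?gt_eqF// ger0_norm ?ltW// /b /a -expRD expRK.
  by congr (_ * _); field.
have p1 : p != 0 by rewrite gt_eqF.
have q1 : q != 0 by rewrite gt_eqF.
exists a, b; split=> //.
  rewrite la /b (_ : p * (a ^+ 2 * A) = a ^+ 2 * (A * p)); last by ring.
  by rewrite /A divfK//; ring.
have e0 : expR t * expR (- t) = 1 by exact: expRxMexpNx_1.
have Et : A + 2 * t = (D2 - P + P * expR (- t)) / q.
  have : 2 * t = c - (P / p * expR t - P / q * expR (- t)).
    by move: kt; rewrite /k; lra.
  by move=> ->; rewrite /A /c; field; rewrite p1 q1.
have ab : a * b = b ^+ 2 * expR (- t).
  by rewrite /b -[LHS]mulr1 -e0; ring.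
rewrite lb Et ab.
have -> : q * (b ^+ 2 * ((D2 - P + P * expR (- t)) / q)) =
    b ^+ 2 * ((D2 - P + P * expR (- t)) / q * q) by ring.
by rewrite divfK//; ring.
Qed.

(** [t (1 + x - ln t) <= e^x] is [1 + y <= e^y] at [y = x - ln t]. *)
Lemma scaled_le_exp (a D p : R) : 0 < a -> 0 < p ->
  a ^+ 2 * p + a ^+ 2 * D - p * xlog a <= p * expR (D / p).
Proof.
move=> a0 p0; have a2 : 0 < a ^+ 2 by rewrite exprn_gt0.
have := expR_ge1Dx (D / p - ln (a ^+ 2)).
rewrite expRD expRN lnK ?posrE// => /(ler_wpM2l (ltW a2)).
rewrite (mulrC (expR _)) mulVKf ?gt_eqF// => /(ler_wpM2l (ltW p0)).
apply: le_trans; rewrite le_eqVlt; apply/orP; left; apply/eqP; rewrite /xlog.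
by field; rewrite gt_eqF.
Qed.

(** The interaction [P] between the two parts contributes [- P (a - b)^2]. *)
Lemma nehari_mass_le (a b D1 D2 P p q : R) :
  0 < a -> 0 < b -> 0 < p -> 0 < q -> 0 <= P ->
  a ^+ 2 * (D1 - P) - p * xlog a + a * b * P = 0 ->
  b ^+ 2 * (D2 - P) - q * xlog b + a * b * P = 0 ->
  a ^+ 2 * p + b ^+ 2 * q <= p * expR (D1 / p) + q * expR (D2 / q).
Proof.
move=> a0 b0 p0 q0 P0 Ea Eb.
have h1 := scaled_le_exp D1 a0 p0; have h2 := scaled_le_exp D2 b0 q0.
have h3 : 0 <= P * (a - b) ^+ 2 by rewrite mulr_ge0// sqr_ge0.
have h4 : P * (a - b) ^+ 2 = a ^+ 2 * P + b ^+ 2 * P - 2 * (a * b * P) by ring.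
rewrite !mulrBr in Ea Eb; lra.
Qed.

Lemma lsum_sqr_gt0 phi : l2 phi -> phi <> cst 0 -> 0 < lsum (fun x => phi x ^+ 2).
Proof.
move=> sp np; have [x px] : exists x, phi x != 0.
  apply: contrapT => H; apply: np; apply/funext => x; apply/eqP.
  by apply: contrapT => /negP px; apply: H; exists x.
by apply: lt_le_trans (l2_sqr_le x sp); rewrite exprn_even_gt0.
Qed.

Context (w : T -> T -> R) (W : R) (hw : bounded_weight w W).
Context (h : T -> R) (h0 : R) (h0_gt : -1 < h0) (h_ge : forall x, h0 <= h x).

Local Notation adm := (admissible h).
Local Notation mass phi := (lsum (fun x => phi x ^+ 2)).
Local Notation combo a b u := (fun x => a * pos_part u x + b * neg_part u x).

Lemma potentialZ x a (t : R) :
  potential h x (a * t) = a ^+ 2 * potential h x t - xlog a * t ^+ 2.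
Proof. by rewrite /potential xlogM exprMn; ring. Qed.

Lemma pos_part_combo a b u : 0 < a -> 0 < b ->
  pos_part (combo a b u) = fun x => a * pos_part u x.
Proof.
move=> a0 b0; apply/funext => x; rewrite /pos_part /neg_part.
have [ux|ux] := leP (u x) 0.
  by rewrite mulr0 add0r max_r// mulr_ge0_le0// ltW.
by rewrite mulr0 addr0 max_l// mulr_ge0// ltW.
Qed.

Lemma neg_part_combo a b u : 0 < a -> 0 < b ->
  neg_part (combo a b u) = fun x => b * neg_part u x.
Proof.
move=> a0 b0; apply/funext => x; rewrite /pos_part /neg_part.
have [ux|ux] := leP (u x) 0.
  by rewrite mulr0 add0r min_l// mulr_ge0_le0// ltW.
by rewrite mulr0 addr0 min_r// mulr_ge0// ltW.
Qed.

Lemma energy_pos_neg_ge0 u : 0 <= energy w (pos_part u) (neg_part u).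
Proof.
rewrite energyE; apply: lsum_ge0 => x; apply: (gradient_ge0 hw) => y.
exact: (homo_mul_ge0 (u x) (u y) (@homo_max0 R) (@homo_min0 R)).
Qed.

Lemma lsum_potentialZ a phi : adm phi ->
  lsum (fun x => potential h x (a * phi x)) =
  a ^+ 2 * lsum (fun x => potential h x (phi x)) - xlog a * mass phi.
Proof.
move=> sp; have sP := potential_summ h0_gt h_ge sp.
have s2 := admissible_l2 h0_gt h_ge sp.
rewrite -(lsumZ _ sP) -(lsumZ _ s2) -lsumB; [|exact: summZ|exact: summZ].
by congr lsum; apply/funext => x; exact: potentialZ.
Qed.

(** The left-hand sides of the equations solved in [nehari_scalings]. *)
Lemma dJ_combo_pos a b u : adm u -> 0 < a -> 0 < b ->
  dJ w h (combo a b u) (pos_part (combo a b u)) =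
  a ^+ 2 * (dJ w h u (pos_part u) - energy w (pos_part u) (neg_part u))
  - mass (pos_part u) * xlog a + a * b * energy w (pos_part u) (neg_part u).
Proof.
move=> su a0 b0; have sv := admissible_combo h0_gt h_ge a b su.
have sp := admissible_part h0_gt h_ge (pos_part_is_part u) su.
have sn := admissible_part h0_gt h_ge (neg_part_is_part u) su.
have q := admissible_l2 h0_gt h_ge su; have [qp qn] := l2_posneg q.
have qv := admissible_l2 h0_gt h_ge sv.
rewrite (dJ_part hw h0_gt h_ge (pos_part_is_part _) sv).
rewrite (dJ_part hw h0_gt h_ge (pos_part_is_part _) su).
rewrite pos_part_combo// lsum_potentialZ//.
have -> : (fun x => a * pos_part u x) = combo a 0 u.
  by apply/funext => x; rewrite mul0r addr0.
rewrite (energy_linr hw)// !(energy_lin hw)//.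
have := energy_lin hw 1 1 qp qn qp.
rewrite -posDneg !mul1r (energyC w (neg_part u) (pos_part u)) => ->.
by ring.
Qed.

Lemma dJ_combo_neg a b u : adm u -> 0 < a -> 0 < b ->
  dJ w h (combo a b u) (neg_part (combo a b u)) =
  b ^+ 2 * (dJ w h u (neg_part u) - energy w (pos_part u) (neg_part u))
  - mass (neg_part u) * xlog b + a * b * energy w (pos_part u) (neg_part u).
Proof.
move=> su a0 b0; have sv := admissible_combo h0_gt h_ge a b su.
have sp := admissible_part h0_gt h_ge (pos_part_is_part u) su.
have sn := admissible_part h0_gt h_ge (neg_part_is_part u) su.
have q := admissible_l2 h0_gt h_ge su; have [qp qn] := l2_posneg q.
have qv := admissible_l2 h0_gt h_ge sv.
rewrite (dJ_part hw h0_gt h_ge (neg_part_is_part _) sv).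
rewrite (dJ_part hw h0_gt h_ge (neg_part_is_part _) su).
rewrite neg_part_combo// lsum_potentialZ//.
have -> : (fun x => b * neg_part u x) = combo 0 b u.
  by apply/funext => x; rewrite mul0r add0r.
rewrite (energy_linr hw)// !(energy_lin hw)//.
have := energy_lin hw 1 1 qp qn qn; rewrite -posDneg !mul1r => ->.
by rewrite (energyC w (neg_part u) (pos_part u)); ring.
Qed.

(** The right-hand side bounds [J (a u^+ + b u^-)] for all [a, b > 0], in
    particular where this combination lies on the manifold; it equals [J u] when
    [u] itself does. *)
Lemma ground_level_le u : adm u -> sign_changing u ->
  (ground_level w h <= (2^-1 *
     (mass (pos_part u) * expR (dJ w h u (pos_part u) / mass (pos_part u)) +
      mass (neg_part u) * expR (dJ w h u (neg_part u) / mass (neg_part u))))%:E)%E.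
Proof.
move=> su [up un].
have q := admissible_l2 h0_gt h_ge su; have [qp qn] := l2_posneg q.
have p0 := lsum_sqr_gt0 qp up; have n0 := lsum_sqr_gt0 qn un.
have P0 := energy_pos_neg_ge0 u.
have [a [b [a0 b0 Ea Eb]]] := nehari_scalings (dJ w h u (pos_part u))
  (dJ w h u (neg_part u)) p0 n0 P0.
have sv := admissible_combo h0_gt h_ge a b su.
have Dp : dJ w h (combo a b u) (pos_part (combo a b u)) = 0.
  by rewrite dJ_combo_pos.
have Dn : dJ w h (combo a b u) (neg_part (combo a b u)) = 0.
  by rewrite dJ_combo_neg.
have : (ground_level w h <= J w h (combo a b u))%E.
  apply: ereal_inf_lbound; exists (combo a b u) => //; split=> //.
    exact/(DJP hw h0_gt h_ge).
  split; rewrite ?pos_part_combo ?neg_part_combo// => E.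
    apply: up; apply/funext => x; move/(congr1 (fun f => f x)): E => /eqP.
    by rewrite mulf_eq0 gt_eqF//= => /eqP.
  apply: un; apply/funext => x; move/(congr1 (fun f => f x)): E => /eqP.
  by rewrite mulf_eq0 gt_eqF//= => /eqP.
move=> /le_trans; apply; rewrite (JE hw h0_gt h_ge sv) lee_fin.
rewrite (dJ_posneg hw h0_gt h_ge sv) Dp Dn !addr0 ler_pM2l ?invr_gt0//.
by rewrite lsum_posneg// (nehari_mass_le a0 b0 p0 n0 P0 Ea Eb).
Qed.

End projection.

(** * A minimizer on the Nehari manifold *)

Section pointwise_limits.
Context {R : realType} {I : Type} (U : set_system I).

(** With an ultrafilter all coordinates of a bounded sequence of functions
    converge at once, without extraction of subsequences. *)
Lemma ultra_bounded_cvg (UU : UltraFilter U) (f : I -> R) (B : R) :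
  (forall i, `|f i| <= B) -> exists l : R, f i @[i --> U] --> l.
Proof.
move=> fB; have K := @segment_compact R (- B) B.
have H : U (f @^-1` `[- B, B]).
  by apply: filterE => i /=; rewrite in_itv /= -ler_norml; exact: fB.
have [p [_ cp]] := K (f @ U) _ H.
exists p => A pA; have [//|nA] := in_ultra_setVsetC (f @^-1` A) UU.
have [z [/= nAz Az]] := cp (~` A) A nA pA.
by [].
Qed.

Lemma cvg_near_ge (FU : ProperFilter U) (f : I -> R) (l e : R) :
  f i @[i --> U] --> l -> 0 < e -> \forall i \near U, l - e <= f i.
Proof.
move=> /cvgrPdist_le H /H; apply: filterS => i.
by rewrite ler_norml => /andP[_]; lra.
Qed.

Lemma cvg_comp_continuous (FU : ProperFilter U) (f : I -> R) (l : R) (g : R -> R) :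
  continuous g -> f i @[i --> U] --> l -> g (f i) @[i --> U] --> g l.
Proof. by move=> cg fl; apply: continuous_cvg => //; exact: cg. Qed.

End pointwise_limits.

Section minimizer.
Context {R : realType} {d : nat}.
Local Notation T := (Zd d).
Implicit Types (u v phi : T -> R) (x y : T).

Local Notation l2 u := (summ (fun x => u x ^+ 2)).

Context (w : T -> T -> R) (W : R) (hw : bounded_weight w W).
Context (h : T -> R) (h0 : R) (h0_gt : -1 < h0) (h_ge : forall x, h0 <= h x).
Context (h_coercive : forall A, exists s : seq T, forall x, h x < A -> x \in s).

Local Notation adm := (admissible h).
Local Notation mass phi := (lsum (fun x => phi x ^+ 2)).

Lemma potentialE x (t : R) : potential h x t = t ^+ 2 * (h x - ln (t ^+ 2)).
Proof. by rewrite /potential /xlog; ring. Qed.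

Lemma continuous_sqr : continuous (fun t : R => t ^+ 2).
Proof. by move=> t; exact: exprn_continuous. Qed.

Lemma continuous_potential x : continuous (potential h x).
Proof.
move=> t; apply: cvgB; last exact: continuous_xlog.
by apply: cvgMr; exact: continuous_sqr.
Qed.

(** Otherwise [potential h] is nonnegative on [phi] and positive somewhere. *)
Lemma part_large_somewhere phi u : adm u -> is_part phi u ->
  dJ w h u phi <= 0 -> phi <> cst 0 ->
  exists x, phi x != 0 /\ h x <= ln (phi x ^+ 2).
Proof.
move=> su pu D0 np; apply: contrapT => H.
have lt_h x : phi x != 0 -> ln (phi x ^+ 2) < h x.
  by move=> px; rewrite ltNge; apply/negP => hx; apply: H; exists x.
have pot0 x : 0 <= potential h x (phi x).
  rewrite potentialE; have [->|/lt_h lh] := eqVneq (phi x) 0.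
    by rewrite expr0n mul0r.
  by rewrite mulr_ge0 ?sqr_ge0// subr_ge0 ltW.
have [x px] : exists x, phi x != 0.
  apply: contrapT => H'; apply: np; apply/funext => x; apply/eqP.
  by apply: contrapT => /negP px; apply: H'; exists x.
have sp := admissible_part h0_gt h_ge pu su.
have := summ_le_point x (potential_summ h0_gt h_ge sp) pot0.
have : 0 < potential h x (phi x).
  by rewrite potentialE mulr_gt0 ?exprn_even_gt0// subr_gt0 lt_h.
have := energy_part_ge0 hw pu.
by move: D0; rewrite (dJ_part hw h0_gt h_ge pu su); lra.
Qed.

(** Outside the finite set where [h < |ln B|] the potential is nonnegative on
    [t^2 <= B]. *)
Lemma potential_minorant (B : R) : 0 < B -> exists2 g : T -> R, summ g &
  forall x t, t ^+ 2 <= B -> - g x <= potential h x t.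
Proof.
move=> B0; have [s hs] := h_coercive `|ln B|.
pose C := B * (1 + `|ln B|).
have C0 : 0 <= C by rewrite mulr_ge0 ?ltW// addr_gt0// ltr_pwDl.
pose g x := if x \in undup s then C else 0.
have [|sg _] := @seq_supportE R d (undup s) g (undup_uniq s).
  by rewrite /g => x /negPf ->.
exists g => // x t tB; rewrite /g potentialE mem_undup.
have [->|t0] := eqVneq t 0.
  by rewrite expr0n mul0r oppr_le0; case: ifP.
have t2 : 0 < t ^+ 2 by rewrite exprn_even_gt0.
have lB : ln (t ^+ 2) <= `|ln B|.
  by apply: le_trans (ler_norm _); rewrite ler_ln ?posrE.
case: ifPn => xs; last first.
  rewrite oppr0; apply: mulr_ge0; first exact: ltW.
  by rewrite subr_ge0 (le_trans lB)// leNgt; apply: contra xs => /hs.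
have hx : -1 <= h x by apply: ltW; apply: lt_le_trans (h_ge x).
have h1 : t ^+ 2 * (1 + `|ln B|) <= C by rewrite ler_wpM2r// addr_ge0.
rewrite lerNl (le_trans _ h1)// -mulrN ler_pM2l//; lra.
Qed.

Section limit.
Context (U : set_system nat) (FU : ProperFilter U).
Context (F : nat -> T -> R) (u : T -> R) (B : R) (B_gt0 : 0 < B).
Context (Fu : forall x, F n x @[n --> U] --> u x).
Context (F_adm : forall n, adm (F n)) (F_mass : forall n, mass (F n) <= B).

Lemma sequence_bounded n x : F n x ^+ 2 <= B.
Proof.
by apply: le_trans (F_mass n); apply: l2_sqr_le; exact: (admissible_l2 h0_gt h_ge).
Qed.

Lemma limit_mass_le c : (\forall n \near U, mass (F n) <= c) ->
  l2 u /\ mass u <= c.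
Proof.
move=> Fc; apply: (@fatou_ge0 R d nat U FU (fun n x => F n x ^+ 2)).
- by move=> x; rewrite sqr_ge0.
- apply: filterS Fc => n Fn; split=> //; last by move=> x; rewrite sqr_ge0.
  exact: (admissible_l2 h0_gt h_ge).
move=> x e e0; apply: cvg_near_ge => //.
exact: (cvg_comp_continuous FU continuous_sqr (@Fu x)).
Qed.

(** [density <= potential + (1 + 2 |ln B|) t^2], and the total potential is
    [- energy <= 0] on the Nehari manifold. *)
Lemma limit_admissible : (forall n, dJ w h (F n) (F n) = 0) -> adm u.
Proof.
move=> DF; pose C := (1 + 2 * `|ln B|) * B.
have [] // := @fatou_ge0 R d nat U FU (fun n => density h (F n)) (density h u) C.
- by move=> x; exact: (density_ge0 h0_gt h_ge).
- apply: nearW => n; have sF := F_adm n; split=> //.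
    by move=> x; exact: (density_ge0 h0_gt h_ge).
  have sq := admissible_l2 h0_gt h_ge sF; have sP := potential_summ h0_gt h_ge sF.
  have sq' := summZ (1 + 2 * `|ln B|) sq.
  apply: le_trans (lsum_le sF (summD sP sq') _) _ => [x|].
    have := norm_xlog_le (sequence_bounded n x).
    by rewrite /density /potential; lra.
  rewrite lsumD// lsumZ//.
  have := DF n; rewrite (dJ_part hw h0_gt h_ge (is_part_refl _) sF).
  have := energy_ge0 hw (F n) => e0 /eqP; rewrite addrC addr_eq0 => /eqP ->.
  rewrite /C -[X in _ <= X]add0r lerD ?oppr_le0//.
  by rewrite ler_wpM2l// addr_ge0// mulr_ge0.
move=> x e e0; apply: cvg_near_ge => //; apply: cvgD.
  by apply: cvgMr; exact: (cvg_comp_continuous FU continuous_sqr (@Fu x)).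
by apply: cvg_norm; exact: (cvg_comp_continuous FU (@continuous_xlog R) (@Fu x)).
Qed.

(* c is max(., 0) or min(., 0) *)
Context (c : R -> R) (c_cont : continuous c).
Context (c_part : forall v : T -> R, is_part (fun x => c (v x)) v).
Local Notation cut v := (fun x => c (v x)).

(** Only an inequality survives in the limit; [nehari_minimizer] recovers the
    equality. *)
Lemma limit_dJ_le0 : adm u -> (forall n, dJ w h (F n) (cut (F n)) = 0) ->
  dJ w h u (cut u) <= 0.
Proof.
move=> su DF; have [g sg gP] := potential_minorant B_gt0.
have cvgc x : c (F n x) @[n --> U] --> c (u x).
  exact: (cvg_comp_continuous FU c_cont (@Fu x)).
have adm_cut v : adm v -> adm (cut v).
  by move=> sv; exact: (admissible_part h0_gt h_ge (c_part v)).
have l2c v : adm v -> l2 (cut v).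
  by move=> /adm_cut; exact: (admissible_l2 h0_gt h_ge).
have l2v v : adm v -> l2 v by exact: (admissible_l2 h0_gt h_ge).
have su_grad := gradient_summ hw (l2v _ su) (l2c _ su).
have su_pot := potential_summ h0_gt h_ge (adm_cut _ su).
have cB v x : v x ^+ 2 <= B -> c (v x) ^+ 2 <= B.
  by case: ((c_part v).1 x) => /= -> // _; rewrite expr0n ltW.
have uB x : u x ^+ 2 <= B.
  have C : F n x ^+ 2 @[n --> U] --> u x ^+ 2.
    by exact: (cvg_comp_continuous FU continuous_sqr (@Fu x)).
  rewrite -(cvg_lim _ C)//; apply: limr_le; first by apply/cvg_ex; eexists; exact: C.
  by apply: nearW => n; exact: sequence_bounded.
have grad0 v x : 0 <= gradient w v (cut v) x.
  by apply: (gradient_ge0 hw) => y; exact: (c_part v).2.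
rewrite (dJ_part hw h0_gt h_ge (c_part u) su) energyE -lsumD//.
apply: (@fatou_minorant R d nat U FU
  (fun n x => gradient w (F n) (cut (F n)) x + potential h x (c (F n x))) _ g).
- exact: summD.
- exact: sg.
- by move=> x; rewrite -[X in X <= _]add0r lerD// gP// cB.
- apply: nearW => n; have sF := F_adm n.
  have sG := gradient_summ hw (l2v _ sF) (l2c _ sF).
  have sP := potential_summ h0_gt h_ge (adm_cut _ sF).
  split; first exact: summD.
    by move=> x; rewrite -[X in X <= _]add0r lerD// gP// cB// sequence_bounded.
  by rewrite lsumD// -energyE -(dJ_part hw h0_gt h_ge (c_part _) sF) DF.
move=> x e e0; have e2 : 0 < e / 2 by rewrite divr_gt0.
have h1 : \forall n \near U,
    gradient w u (cut u) x - e / 2 <= gradient w (F n) (cut (F n)) x.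
  apply: (liminf_gradient hw FU) => // [n|n|||n y].
  - exact: l2v.
  - exact: l2c.
  - exact: l2v.
  - exact: l2c.
  exact: (c_part (F n)).2.
have h2 : \forall n \near U,
    potential h x (c (u x)) - e / 2 <= potential h x (c (F n x)).
  apply: cvg_near_ge => //.
  exact: (cvg_comp_continuous FU (@continuous_potential x) (cvgc x)).
near=> n.
have -> : e = e / 2 + e / 2 by rewrite -splitr.
by rewrite opprD addrACA lerD//; near: n.
Unshelve. all: by end_near. Qed.

(** By [part_large_somewhere] each [cut (F n)] is at least [e^(h0/2)] in absolute
    value at some point where [h <= |ln B|], that is, in a finite set that does
    not depend on [n].  Nothing escapes to infinity from there. *)
Lemma limit_cut_neq0 : (forall n, dJ w h (F n) (cut (F n)) = 0) ->
  (forall n, cut (F n) <> cst 0) -> cut u <> cst 0.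
Proof.
move=> DF cF cu0; have [s hs] := h_coercive (`|ln B| + 1).
pose r := expR h0; have r0 : 0 < r by exact: expR_gt0.
have sum_ge n : r <= \sum_(x <- s) c (F n x) ^+ 2.
  have [|x [cx hx]] := part_large_somewhere (F_adm n) (c_part (F n)) _ (cF n).
    by rewrite DF.
  have c2 : 0 < c (F n x) ^+ 2 by rewrite exprn_even_gt0.
  have xs : x \in s.
    apply: hs; apply: (@le_lt_trans _ _ (ln (c (F n x) ^+ 2))) => //.
    apply: (@le_lt_trans _ _ `|ln B|); last by rewrite ltrDl.
    apply: le_trans (ler_norm _); rewrite ler_ln ?posrE//.
    case: ((c_part (F n)).1 x) => /= ->; last by rewrite expr0n ltW.
    exact: sequence_bounded.
  rewrite (big_rem x)//= -[r]addr0 lerD ?sumr_ge0//.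
    by rewrite -ler_ln ?posrE// /r expRK (le_trans (h_ge x)).
  by move=> y _; exact: sqr_ge0.
have r2 : 0 < r / 2 by rewrite divr_gt0.
have H : \forall n \near U,
    \sum_(x <- s) - c (u x) ^+ 2 - r / 2 <= \sum_(x <- s) - c (F n x) ^+ 2.
  apply: (near_sum_ge FU _ _ r2) => x e e0.
  apply: cvg_near_ge => //; apply: cvgN.
  apply: (cvg_comp_continuous FU continuous_sqr).
  exact: (cvg_comp_continuous FU c_cont (@Fu x)).
have [n] := @filter_ex _ _ FU _ H.
have -> : \sum_(x <- s) - c (u x) ^+ 2 = 0.
  rewrite big1// => x _; move/(congr1 (fun f => f x)): cu0 => /= ->.
  by rewrite expr0n oppr0.
by rewrite sumrN; have := sum_ge n; lra.
Qed.

End limit.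

Lemma mass_posneg u : l2 u -> mass u = mass (pos_part u) + mass (neg_part u).
Proof.
move=> su; have := lsum_posneg 1 1 su; rewrite expr1n [X in _ = X + _]mul1r.
by rewrite [X in _ = _ + X]mul1r => <-; rewrite [in LHS](posDneg u).
Qed.

Lemma nehariP u : nehari w h u <-> [/\ adm u, sign_changing u,
  dJ w h u (pos_part u) = 0 & dJ w h u (neg_part u) = 0].
Proof.
by split=> -[a b e f]; split=> //; apply/(DJP hw h0_gt h_ge).
Qed.

Lemma nehari_dJ u : nehari w h u -> dJ w h u u = 0.
Proof.
by move=> /nehariP[su _ p n]; rewrite (dJ_posneg hw h0_gt h_ge su) p n addr0.
Qed.

Lemma nehari_J u : nehari w h u -> J w h u = (2^-1 * mass u)%:E.
Proof.
move=> nu; have /nehariP[su _ _ _] := nu.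
by rewrite (JE hw h0_gt h_ge su) nehari_dJ// addr0.
Qed.

(** The level is finite because the projection applies to
    [delta_x1 - delta_x2]. *)
Lemma ground_level_fin x1 x2 : x1 != x2 ->
  exists2 m : R, 0 <= m & ground_level w h = m%:E.
Proof.
move=> x12; pose v x : R := if x == x1 then 1 else if x == x2 then -1 else 0.
have sv : adm v.
  pose v1 x : R := if x == x1 then 1 else 0.
  have s1 : adm v1.
    apply: (admissible_update (admissible0 h) (x := x1)) => y /negPf yx.
    by rewrite /v1 yx.
  apply: (admissible_update s1 (x := x2)) => y /negPf yx; by rewrite /v /v1 yx.
have cv : sign_changing v.
  split=> [/(congr1 (fun f => f x1))|/(congr1 (fun f => f x2))].
    rewrite /pos_part /v eqxx max_l// => /eqP; by rewrite oner_eq0.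
  rewrite /neg_part /v eq_sym (negPf x12) eqxx min_l ?oppr_le0//.
  by move=> /eqP; rewrite oppr_eq0 oner_eq0.
have := ground_level_le hw h0_gt h_ge sv cv.
have : (0 <= ground_level w h)%E.
  apply: le_ereal_inf_tmp => _ [u nu <-]; rewrite nehari_J// lee_fin.
  by rewrite mulr_ge0// lsum_ge0// => x; rewrite sqr_ge0.
case: (ground_level w h) => [m| |]//; rewrite lee_fin => m0 _; by exists m.
Qed.

Lemma expR_le1_eq (a p D : R) : 0 < p -> D <= 0 ->
  p * expR (D / p) <= p /\ (p <= p * expR (D / p) -> D = 0).
Proof.
move=> p0 D0; have Dp : D / p <= 0 by rewrite pmulr_lle0 ?invr_gt0.
split; first by rewrite ler_piMr ?expR_le1// ltW.
rewrite ler_pMr// => e1; have : D / p == 0.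
  by rewrite eq_le Dp /= leNgt -expR_lt1 -leNgt.
by rewrite mulf_eq0 invr_eq0 (gt_eqF p0) orbF => /eqP.
Qed.

(** Let [u] be the limit of a minimizing sequence, [p] and [q] the squared norms
    of its two parts and [D, E <= 0] the values of [dJ u] at them.  Then
    [2 m <= p e^(D/p) + q e^(E/q) <= p + q <= 2 m] by [ground_level_le] and
    Fatou's lemma, hence [D = E = 0]. *)
Lemma nehari_minimizer x1 x2 : x1 != x2 ->
  exists u, nehari w h u /\ J w h u = ground_level w h.
Proof.
move=> x12; have [m m0 mE] := ground_level_fin x12.
pose B := 2 * m + 2; have B0 : 0 < B by rewrite /B; lra.
have seqP (n : nat) : exists v, nehari w h v /\ mass v <= 2 * m + 2 * n.+1%:R^-1.
  have n0 : 0 < n.+1%:R^-1 :> R by rewrite invr_gt0.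
  have [|y [v nv <-]] :=
    @lb_ereal_inf_adherent R [set J w h v | v in nehari w h] _ n0.
    by rewrite -/(ground_level w h) mE.
  rewrite -/(ground_level w h) mE nehari_J// -EFinD lte_fin => vm.
  by exists v; split=> //; move: vm; rewrite ltr_pdivrMl// mulrDr => /ltW.
have [F FP] := choice seqP.
have F_adm n : adm (F n) by have [/nehariP[]] := FP n.
have inv_le1 n : n.+1%:R^-1 <= 1 :> R by rewrite invf_le1// ler1n.
have F_mass n : mass (F n) <= B.
  have [_ h1] := FP n; apply: le_trans h1 _; rewrite /B lerD2l.
  by rewrite -[X in _ <= X]mulr1 ler_pM2l.
have [U [UU Uoo]] := ultraFilterLemma (eventually_filter : ProperFilter \oo).
have FU : ProperFilter U by exact: ultra_proper.
have Fb n x : `|F n x| <= B + 1.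
  have := sequence_bounded F_adm F_mass n x; rewrite -(real_normK (num_real _)).
  by have := sqr_ge0 (`|F n x| - 1); nra.
have limP x : exists l : R, F n x @[n --> U] --> l.
  exact: (ultra_bounded_cvg UU (fun n => Fb n x)).
have [u Fu] := choice limP.
have su : adm u.
  apply: (limit_admissible FU Fu F_adm F_mass) => n.
  by apply: nehari_dJ; have [] := FP n.
have mu : mass u <= 2 * m.
  apply/ler_addgt0Pr => e e0.
  apply: (limit_mass_le FU Fu F_adm _).2.
  apply: Uoo; near=> n; have [_ h1] := FP n; apply: le_trans h1 _.
  rewrite lerD2l -ler_pdivlMl// ltW//.
  near: n; have e2 : 0 < 2^-1 * e by rewrite mulr_gt0.
  exact: near_infty_natSinv_lt (PosNum e2).
have ccmax : continuous (fun t : R => Num.max t 0).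
  by move=> t; apply: continuous_max => //; exact: cvg_cst.
have ccmin : continuous (fun t : R => Num.min t 0).
  by move=> t; apply: continuous_min => //; exact: cvg_cst.
have Dpn n : dJ w h (F n) (pos_part (F n)) = 0 by have [/nehariP[]] := FP n.
have Dnn n : dJ w h (F n) (neg_part (F n)) = 0 by have [/nehariP[]] := FP n.
have cpn n : pos_part (F n) <> cst 0 by have [/nehariP[_ []]] := FP n.
have cnn n : neg_part (F n) <> cst 0 by have [/nehariP[_ []]] := FP n.
have Dp := limit_dJ_le0 FU B0 Fu F_adm F_mass ccmax (@pos_part_is_part R d) su Dpn.
have Dn := limit_dJ_le0 FU B0 Fu F_adm F_mass ccmin (@neg_part_is_part R d) su Dnn.
have cp := limit_cut_neq0 FU B0 Fu F_adm F_mass ccmax (@pos_part_is_part R d) Dpn cpn.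
have cn := limit_cut_neq0 FU B0 Fu F_adm F_mass ccmin (@neg_part_is_part R d) Dnn cnn.
rewrite -/(pos_part u) in Dp cp; rewrite -/(neg_part u) in Dn cn.
have q := admissible_l2 h0_gt h_ge su; have [qp qn] := l2_posneg q.
have p0 := lsum_sqr_gt0 qp cp; have n0 := lsum_sqr_gt0 qn cn.
have := ground_level_le hw h0_gt h_ge su (conj cp cn); rewrite mE lee_fin.
have [h1 h1'] := expR_le1_eq 0 p0 Dp; have [h2 h2'] := expR_le1_eq 0 n0 Dn.
have mE2 := mass_posneg q; rewrite mE2 in mu.
move=> h3.
have Dp0 : dJ w h u (pos_part u) = 0 by apply: h1'; lra.
have Dn0 : dJ w h u (neg_part u) = 0 by apply: h2'; lra.
have nu : nehari w h u by apply/nehariP.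
exists u; split=> //; rewrite nehari_J//; congr EFin; rewrite mE2; lra.
Unshelve. all: by end_near. Qed.

End minimizer.

(** * Minimizers are critical points *)

Section criticality.
Context {R : realType} {d : nat}.
Local Notation T := (Zd d).
Implicit Types (u v phi : T -> R) (x y : T).

Local Notation l2 u := (summ (fun x => u x ^+ 2)).

Lemma expR_le_quadratic (y : R) : y <= 2^-1 -> expR y <= 1 + y + 2 * y ^+ 2.
Proof.
move=> y2; have y1 : 0 < 1 - y by lra.
have e1 : 1 - y <= (expR y)^-1 by rewrite -expRN; exact: expR_ge1Dx.
have e0 : expR y <= (1 - y)^-1.
  by rewrite -[expR y]invrK lef_pV2 ?posrE ?invr_gt0 ?expR_gt0.
apply: le_trans e0 _; rewrite -[X in X <= _]mul1r ler_pdivrMr//.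
have : 0 <= y ^+ 2 * (1 - 2 * y) by rewrite mulr_ge0 ?sqr_ge0//; lra.
by rewrite (_ : (1 + y + 2 * y ^+ 2) * (1 - y) = 1 + y ^+ 2 * (1 - 2 * y));
  [lra | ring].
Qed.

(** Small [e] of the sign opposite to that of [r] force [|r|] to be small. *)
Lemma first_order_zero (r C e0 : R) : 0 <= C -> 0 < e0 ->
  (forall e, `|e| <= e0 -> - (e * r) <= C * (`|e| * Num.sqrt `|e|)) -> r = 0.
Proof.
move=> C0 e00 H; apply/eqP/negPn/negP => r0.
have n0 : 0 < `|r| by rewrite normr_gt0.
pose b := `|r| / (C + 1); have b0 : 0 < b by rewrite divr_gt0// ltr_wpDl.
pose t := Num.min e0 (b ^+ 2).
have t0 : 0 < t by rewrite lt_min e00 exprn_gt0.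
have tb : Num.sqrt t <= b.
  rewrite -[X in _ <= X](ger0_norm (ltW b0)) -sqrtr_sqr ler_sqrt ?sqr_ge0//.
  by rewrite ge_min lexx orbT.
have h : t * `|r| <= C * (t * Num.sqrt t).
  have [rp|rn] := leP 0 r.
    have := H (- t); rewrite normrN (gtr0_norm t0) ge_min lexx => /(_ isT).
    by rewrite ger0_norm// mulNr opprK.
  have := H t; rewrite (gtr0_norm t0) ge_min lexx => /(_ isT).
  by rewrite ltr0_norm// mulrN.
have {}h : `|r| <= C * b.
  have : t * `|r| <= t * (C * b).
    by apply: le_trans h _; rewrite mulrCA ler_pM2l// ler_wpM2l.
  by rewrite ler_pM2l.
have : C * b < `|r|.
  rewrite /b mulrCA gtr_pMr// ltr_pdivrMr ?ltr_wpDl// mul1r ltrDl//.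
by rewrite ltNge h.
Qed.

Context (w : T -> T -> R) (W : R) (hw : bounded_weight w W).
Context (h : T -> R) (h0 : R) (h0_gt : -1 < h0) (h_ge : forall x, h0 <= h x).

Local Notation adm := (admissible h).
Local Notation mass phi := (lsum (fun x => phi x ^+ 2)).

Definition delta x : T -> R := fun y => (y == x)%:R.

Lemma admissible_delta x : adm (delta x).
Proof.
apply: (admissible_update (admissible0 h) (x := x)) => y /negPf yx.
by rewrite /delta yx.
Qed.

Section perturbation.
Context (u : T -> R) (su : adm u) (x : T).
Local Notation pert e := (fun y => 1 * u y + e * delta x y).

Lemma pertE e y : y != x -> pert e y = u y.
Proof. by move=> /negPf yx; rewrite /delta yx mulr0 addr0 mul1r. Qed.

Lemma pert_at e : pert e x = u x + e.
Proof. by rewrite /delta eqxx mulr1 mul1r. Qed.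

Lemma admissible_pert e : adm (pert e).
Proof. by apply: (admissible_update su (x := x)) => y yx; exact: pertE. Qed.

(** The map [c] is [max(., 0)], [min(., 0)] or the identity. *)
Section cut.
Context (c : R -> R) (c_lip : forall a b, `|c a - c b| <= `|a - b|).
Context (c_part : forall v : T -> R, is_part (fun x => c (v x)) v).
Local Notation cut v := (fun x => c (v x)).
Local Notation incr e := (c (u x + e) - c (u x)).

Lemma cut_pert e : cut (pert e) = fun y => 1 * c (u y) + incr e * delta x y.
Proof.
apply/funext => y; have [->|yx] := eqVneq y x.
  by rewrite pert_at /delta eqxx mulr1 mul1r addrCA subrr addr0.
by rewrite pertE// /delta (negPf yx) mulr0 addr0 mul1r.
Qed.

Lemma incr_le e : `|incr e| <= `|e|.
Proof. by apply: le_trans (c_lip _ _) _; rewrite addrC addKr. Qed.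

Lemma dJ_cut_pert e : dJ w h (pert e) (cut (pert e)) =
  dJ w h u (cut u) + incr e * energy w u (delta x) +
  e * energy w (delta x) (cut u) + e * incr e * energy w (delta x) (delta x) +
  (potential h x (c (u x + e)) - potential h x (c (u x))).
Proof.
have sd := admissible_delta x; have qd := admissible_l2 h0_gt h_ge sd.
have qu := admissible_l2 h0_gt h_ge su.
have sc := admissible_part h0_gt h_ge (c_part u) su.
have qc := admissible_l2 h0_gt h_ge sc.
rewrite (dJ_part hw h0_gt h_ge (c_part _) (admissible_pert e)).
rewrite (dJ_part hw h0_gt h_ge (c_part _) su).
rewrite (@lsum_update R d (fun y t => potential h y (c t)) u (pert e) x); last first.
- exact: (potential_summ h0_gt h_ge sc).
- by move=> y; exact: pertE.
rewrite pert_at cut_pert.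
have qv := l2_lin 1 (incr e) qc qd.
rewrite (energy_lin hw)// !(energy_linr hw)//.
by ring.
Qed.

Lemma mass_cut_pert e :
  mass (cut (pert e)) = mass (cut u) + (c (u x + e) ^+ 2 - c (u x) ^+ 2).
Proof.
rewrite (@lsum_update R d (fun y t => c t ^+ 2) u (pert e) x) ?pert_at//.
  by move=> y; exact: pertE.
exact: (admissible_l2 h0_gt h_ge (admissible_part h0_gt h_ge (c_part u) su)).
Qed.

(** On the manifold [dJ u (cut u) = 0], hence [dJ v (cut v) = O(e)] for the
    perturbation [v], and the exponential is [1 + y + O(y^2)]. *)
Lemma cut_pert_bound : dJ w h u (cut u) = 0 -> cut u <> cst 0 ->
  exists C e0, [/\ 0 <= C, 0 < e0 & forall e, `|e| <= e0 ->
    cut (pert e) <> cst 0 /\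
    mass (cut (pert e)) * expR (dJ w h (pert e) (cut (pert e)) / mass (cut (pert e)))
    <= mass (cut (pert e)) + dJ w h (pert e) (cut (pert e)) + C * e ^+ 2].
Proof.
move=> D0 c0; have sc := admissible_part h0_gt h_ge (c_part u) su.
have qc := admissible_l2 h0_gt h_ge sc.
have p0 := lsum_sqr_gt0 qc c0; set p := mass (cut u) in p0.
have [K K0 HK] := xlog_lipschitz (c (u x)).
pose L := 2 * `|c (u x)| + 1.
have L0 : 0 < L by rewrite ltr_wpDl// mulr_ge0.
pose M := `|energy w u (delta x)| + `|energy w (delta x) (cut u)| +
  energy w (delta x) (delta x) + (`|h x| * L + K).
have Ed := energy_ge0 hw (delta x).
have M0 : 0 <= M by rewrite !addr_ge0// mulr_ge0// ltW.
(* these bounds on |e| make the increment of c (u x) at most 1, the perturbed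
   mass at least p / 2, and the argument of the exponential at most 1/2 *)
pose e0 := Num.min 1 (Num.min (p / (2 * L)) (p / (4 * (M + 1)))).
have M1 : 0 < M + 1 by rewrite ltr_wpDl.
have e00 : 0 < e0.
  by rewrite !lt_min ltr01 !divr_gt0// mulr_gt0.
exists (4 * M ^+ 2 / p), e0; split=> //.
  by rewrite divr_ge0 ?(ltW p0)// mulr_ge0// sqr_ge0.
move=> e; rewrite !le_min => /andP[e1 /andP[eL eM]].
have ie := incr_le e; have ie1 : `|incr e| <= 1 by exact: le_trans e1.
have sqE : c (u x + e) ^+ 2 - c (u x) ^+ 2 = incr e * (2 * c (u x) + incr e).
  by ring.
have sqL : `|c (u x + e) ^+ 2 - c (u x) ^+ 2| <= `|e| * L.
  rewrite sqE normrM ler_pM// (le_trans (ler_normD _ _))// lerD//.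
  by rewrite normrM ger0_norm.
have mE := mass_cut_pert e; rewrite -/p in mE.
set P := mass (cut (pert e)) in mE *.
have Pp : p / 2 <= P.
  have : `|e| * L <= p / 2.
    by move: eL; rewrite ler_pdivlMr ?mulr_gt0// => h1; lra.
  by move: sqL; rewrite ler_norml mE => /andP[]; lra.
have P0 : 0 < P by apply: lt_le_trans Pp; rewrite divr_gt0.
set D := dJ w h (pert e) (cut (pert e)).
have DM : `|D| <= M * `|e|.
  rewrite /D dJ_cut_pert D0 add0r /M [X in _ <= X]mulrDl [X in _ <= X + _]mulrDl
    [X in _ <= X + _ + _]mulrDl [X in _ <= _ + X]mulrDl.
  have pot : `|potential h x (c (u x + e)) - potential h x (c (u x))| <=
      `|h x| * L * `|e| + K * `|e|.
    have -> : potential h x (c (u x + e)) - potential h x (c (u x)) =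
        h x * (c (u x + e) ^+ 2 - c (u x) ^+ 2) -
        (xlog (c (u x) + incr e) - xlog (c (u x))).
      by rewrite addrCA subrr addr0 /potential; ring.
    rewrite (le_trans (ler_normB _ _))// lerD//.
      by rewrite normrM -mulrA ler_wpM2l// mulrC.
    by rewrite (le_trans (HK _ ie1))// ler_wpM2l.
  rewrite (le_trans (ler_normD _ _))// lerD//.
  rewrite (le_trans (ler_normD _ _))// lerD//.
    rewrite (le_trans (ler_normD _ _))// lerD//.
      by rewrite normrM mulrC ler_wpM2l.
    by rewrite normrM mulrC.
  rewrite normrM (ger0_norm Ed) mulrC ler_wpM2l// normrM.
  by rewrite ler_piMr.
split.
  move=> cv; have : P = 0.
    have -> : P = lsum (fun _ : T => 0 : R).
      congr lsum; apply/funext => y; move/(congr1 (fun f => f y)): cv => /= ->.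
      by rewrite expr0n.
    exact: lsum0.
  by move=> PE; rewrite PE ltxx in P0.
have Dp : `|D| <= p / 4.
  apply: le_trans DM _; rewrite mulrC.
  move: eM; rewrite ler_pdivlMr ?mulr_gt0// => h1.
  have : `|e| * M <= `|e| * (M + 1) by rewrite ler_wpM2l// lerDl.
  lra.
have DP : D / P <= 2^-1.
  rewrite ler_pdivrMr//; have := ler_norm D; lra.
have := ler_wpM2l (ltW P0) (expR_le_quadratic DP).
move=> /le_trans; apply.
have -> : P * (1 + D / P + 2 * (D / P) ^+ 2) = P + D + 2 * D ^+ 2 / P.
  by field; rewrite gt_eqF.
rewrite lerD2l.
have D2 : D ^+ 2 <= M ^+ 2 * e ^+ 2.
  rewrite -(real_normK (num_real D)) -(real_normK (num_real e)) -exprMn.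
  by rewrite lerXn2r ?nnegrE ?mulr_ge0.
rewrite ler_pdivrMr//; apply: le_trans (_ : 2 * (M ^+ 2 * e ^+ 2) <= _).
  by rewrite ler_pM2l.
have -> : 4 * M ^+ 2 / p * e ^+ 2 * P = 2 * (M ^+ 2 * e ^+ 2) * (2 * P / p).
  by field; rewrite gt_eqF.
have Me0 : 0 <= 2 * (M ^+ 2 * e ^+ 2) by rewrite -exprMn mulr_ge0// sqr_ge0.
by rewrite ler_peMr// ler_pdivlMr//; lra.
Qed.

End cut.

Lemma lip_max0 (a b : R) : `|Num.max a 0 - Num.max b 0| <= `|a - b|.
Proof.
case: (leP a 0) => a0; case: (leP b 0) => b0; rewrite ?subrr ?normr0//.
- by rewrite sub0r normrN gtr0_norm// ler0_norm; lra.
- by rewrite subr0 gtr0_norm// ger0_norm; lra.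
Qed.

Lemma lip_min0 (a b : R) : `|Num.min a 0 - Num.min b 0| <= `|a - b|.
Proof.
case: (leP a 0) => a0; case: (leP b 0) => b0; rewrite ?subrr ?normr0//.
- by rewrite subr0 ler0_norm// ler0_norm; lra.
- by rewrite sub0r normrN ler0_norm// ger0_norm; lra.
Qed.

End perturbation.

(** By [ground_level_le] the perturbation [v] of a minimizer [u] satisfies
    [m <= J v + O(e^2)], while [J v = m + e (dJ u delta) + O(|e|^(3/2))].  Taking
    [e] of both signs gives the claim.  Points where [u x = 0] are no exception:
    there the remainder is governed by [e^2 ln e^2]. *)
Lemma minimizer_critical_delta u x : nehari w h u ->
  J w h u = ground_level w h -> dJ w h u (delta x) = 0.
Proof.
move=> nu Ju; have /(nehariP hw h0_gt h_ge)[su [up un] Dp Dn] := nu.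
have [C1 [e1 [C10 e10 H1]]] :=
  cut_pert_bound su x lip_max0 (@pos_part_is_part R d) Dp up.
have [C2 [e2 [C20 e20 H2]]] :=
  cut_pert_bound su x lip_min0 (@neg_part_is_part R d) Dn un.
have [C3 C30 H3] := xlog_expansion (u x).
have sd := admissible_delta x; have qd := admissible_l2 h0_gt h_ge sd.
have qu := admissible_l2 h0_gt h_ge su.
have Ed := energy_ge0 hw (delta x).
pose A := energy w (delta x) (delta x) + `|h x + 1|.
have A0 : 0 <= A by rewrite addr_ge0.
apply: (@first_order_zero _ (2^-1 * (C1 + C2 + A + C3)) (Num.min 1 (Num.min e1 e2))).
- by rewrite mulr_ge0// !addr_ge0.
- by rewrite !lt_min ltr01 e10.
move=> e; rewrite !le_min => /andP[le1 /andP[/H1[cp B1] /H2[cn B2]]].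
set v := (fun y => 1 * u y + e * delta x y) in cp B1 cn B2.
have sv : adm v by exact: admissible_pert.
have := ground_level_le hw h0_gt h_ge sv (conj cp cn).
rewrite -Ju (nehari_J hw h0_gt h_ge nu) lee_fin ler_pM2l ?invr_gt0// => Hm.
have Jv : mass v + dJ w h v v = mass u + 2 * e * dJ w h u (delta x) +
    e ^+ 2 * (energy w (delta x) (delta x) + (h x + 1)) -
    (xlog (u x + e) - xlog (u x) - e * (2 * u x * ln (u x ^+ 2) + 2 * u x)).
  have := dJ_cut_pert su x (c := id) (@is_part_refl R d) e.
  have := mass_cut_pert su x (c := id) (@is_part_refl R d) e.
  rewrite -/v => -> ->.
  rewrite (nehari_dJ hw h0_gt h_ge nu) (energyC w (delta x) u).
  rewrite (dJE hw h0_gt h_ge su sd).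
  have [|_ ->] := @seq_supportE R d [:: x] (fun y => h y * u y * delta x y -
      u y * delta x y * ln (u y ^+ 2)) isT.
    by move=> y; rewrite inE /delta => /negPf ->; rewrite !mulr0 mul0r subrr.
  have dxx : delta x x = 1 by rewrite /delta eqxx.
  rewrite big_seq1 dxx /potential; ring.
have rem := H3 _ le1.
set X := xlog _ - _ - _ in Jv rem.
have s0 : 0 <= `|e| * Num.sqrt `|e| by rewrite mulr_ge0// sqrtr_ge0.
have ee : e ^+ 2 <= `|e| * Num.sqrt `|e|.
  rewrite -(real_normK (num_real e)) expr2 ler_wpM2l//.
  rewrite -{1}[`|e|]sqr_sqrtr// expr2 ler_piMl ?sqrtr_ge0//.
  exact: sqrt_norm_le1.
have hA : e ^+ 2 * (energy w (delta x) (delta x) + (h x + 1)) <=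
    A * (`|e| * Num.sqrt `|e|).
  apply: (@le_trans _ _ (e ^+ 2 * A)).
    by rewrite ler_wpM2l ?sqr_ge0// lerD2l ler_norm.
  by rewrite mulrC ler_wpM2l.
have hC1 := ler_wpM2l C10 ee; have hC2 := ler_wpM2l C20 ee.
have qv := admissible_l2 h0_gt h_ge sv.
have mv := mass_posneg qv; have dv := dJ_posneg hw h0_gt h_ge sv.
move: rem; rewrite ler_norml => /andP[rem _].
rewrite -/(pos_part v) in B1; rewrite -/(neg_part v) in B2.
have HH := le_trans Hm (lerD B1 B2).
have -> : 2^-1 * (C1 + C2 + A + C3) * (`|e| * Num.sqrt `|e|) =
  2^-1 * (C1 * (`|e| * Num.sqrt `|e|) + C2 * (`|e| * Num.sqrt `|e|) +
  A * (`|e| * Num.sqrt `|e|) + C3 * (`|e| * Num.sqrt `|e|)) by ring.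
move: HH Jv rem hA hC1 hC2; rewrite mv dv.
set S := `|e| * Num.sqrt `|e|.
have -> : 2 * e * dJ w h u (delta x) = 2 * (e * dJ w h u (delta x)) by rewrite mulrA.
move: (e * dJ w h u (delta x)) (C1 * S) (C2 * S) (A * S) (C3 * S) => z z1 z2 z3 z4.
by lra.
Qed.

Lemma dJ_finite_support u phi (s : seq T) : adm u -> adm phi ->
  (forall x, dJ w h u (delta x) = 0) ->
  dJ w h u (fun y => if y \in s then phi y else 0) = 0.
Proof.
move=> su sp D0.
have sr (r : seq T) : adm (fun y => if y \in r then phi y else 0).
  apply: (admissible_le (C := 1) h0_gt h_ge sp) => y; rewrite mul1r.
  rewrite {1}/density; case: ifP => _; first by [].
  by rewrite xlog0 normr0 expr0n mulr0 addr0 (density_ge0 h0_gt h_ge).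
elim: s => [|a s IH].
  rewrite (dJE hw h0_gt h_ge su (sr [::])).
  have E : (fun y => if y \in [::] then phi y else 0) = fun y => 0 * u y + 0 * u y.
    by apply/funext => y; rewrite !mul0r addr0.
  have q := admissible_l2 h0_gt h_ge su.
  rewrite E (energy_linr hw)// !mul0r addr0 add0r -[RHS](@lsum0 R d).
  by congr lsum; apply/funext => y /=; rewrite ?mul0r ?addr0 !mulr0 mul0r subrr.
have [as_|as_] := boolP (a \in s).
  rewrite -[RHS]IH; congr (dJ _ _ _ _); apply/funext => y; rewrite inE.
  by case: eqVneq => [->|]//=; rewrite as_.
have E : (fun y => if y \in a :: s then phi y else 0) =
    fun y => 1 * (if y \in s then phi y else 0) + phi a * delta a y.
  apply/funext => y; rewrite inE mul1r /delta; case: eqVneq => [->|ya] /=.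
    by rewrite (negPf as_) add0r mulr1.
  by rewrite mulr0 addr0.
have := sr (a :: s); rewrite E => sE.
rewrite (dJ_lin hw h0_gt h_ge su (sr s) (admissible_delta a) sE).
by rewrite IH D0 !mulr0 addr0.
Qed.

(** Cut [phi] off outside a large finite set: the finite part contributes
    nothing, and the contribution of the tail is small. *)
Lemma critical_of_delta u : adm u -> (forall x, dJ w h u (delta x) = 0) ->
  forall phi, adm phi -> dJ w h u phi = 0.
Proof.
move=> su D0 phi sp.
have qu := admissible_l2 h0_gt h_ge su; have qp := admissible_l2 h0_gt h_ge sp.
pose f y := h y * u y * phi y - u y * phi y * ln (u y ^+ 2).
have sf : summ f.
  apply: summB; first exact: (summ_potential_mul h0_gt h_ge).
  exact: (summ_log_mul h0_gt h_ge).
pose g y := `|f y| + phi y ^+ 2.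
have sg : summ g.
  by apply: summD => //; exact: summ_norm.
have g0 y : 0 <= g y by rewrite addr_ge0 ?sqr_ge0.
have W0 : 0 <= W.
  apply: le_trans (offdiag_lsum hw (point : T)).
  by apply: lsum_ge0 => y; exact: (offdiag_ge0 hw).
pose K := energy w u u / 2 + W + 1.
have K0 : 0 < K.
  by rewrite ltr_wpDl// addr_ge0// divr_ge0//; exact: (energy_ge0 hw).
have main c : 0 < c -> c <= 1 -> `|dJ w h u phi| <= c * K.
  (* a tail of size c^2 makes the bound c^2 E(u, u) + E(psi, psi) of Young's
     inequality, which is divided by 2 c, of order c *)
  move=> c0 c1; have [s us sE] := lsum_approx sg g0 (exprn_gt0 2 c0).
  pose psi y := if y \in s then 0 else phi y.
  have spsi : adm psi.
    apply: (admissible_le (C := 1) h0_gt h_ge sp) => y; rewrite mul1r.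
    rewrite {1}/density /psi; case: ifP => _; last by [].
    by rewrite xlog0 normr0 expr0n mulr0 addr0 (density_ge0 h0_gt h_ge).
  have qpsi := admissible_l2 h0_gt h_ge spsi.
  pose gt y := if y \in s then 0 else g y.
  have [|sgs gsE] := @seq_supportE R d s (fun y => if y \in s then g y else 0) us.
    by move=> y /negPf ->.
  have gtE : gt = fun y => g y - (if y \in s then g y else 0).
    by apply/funext => y; rewrite /gt; case: ifP; rewrite ?subrr ?subr0.
  have sgt : summ gt by rewrite gtE; exact: summB.
  have lgt : lsum gt <= c ^+ 2.
    rewrite gtE lsumB// gsE.
    rewrite (eq_big_seq g) => [|y ->]//; lra.
  have -> : dJ w h u phi = dJ w h u psi.
    have E : phi = fun y => 1 * (if y \in s then phi y else 0) + 1 * psi y.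
      by apply/funext => y; rewrite /psi !mul1r; case: ifP; rewrite ?addr0 ?add0r.
    have sr : adm (fun y => if y \in s then phi y else 0).
      apply: (admissible_le (C := 1) h0_gt h_ge sp) => y; rewrite mul1r.
      rewrite {1}/density; case: ifP => _; first by [].
      by rewrite xlog0 normr0 expr0n mulr0 addr0 (density_ge0 h0_gt h_ge).
    rewrite [in LHS]E (dJ_lin hw h0_gt h_ge su sr spsi) -?E//.
    by rewrite (dJ_finite_support s su sp D0) mulr0 add0r mul1r.
  rewrite (dJE hw h0_gt h_ge su spsi).
  have h1 : `|lsum (fun y => h y * u y * psi y -
      u y * psi y * ln (u y ^+ 2))| <= c ^+ 2.
    apply: le_trans lgt; apply: norm_lsum_le => // y; rewrite /psi /gt.
    case: ifP => _; first by rewrite !mulr0 mul0r subrr normr0.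
    by rewrite /g /f lerDl sqr_ge0.
  have h2 : mass psi <= c ^+ 2.
    apply: le_trans lgt; apply: lsum_le => // y; rewrite /psi /gt.
    by case: ifP => _; rewrite ?expr0n// /g lerDr.
  have [_ h3] := energy_bound hw qpsi.
  have h4 := energy_young hw qu qpsi c0.
  have h5 : 2 * W * mass psi <= 2 * W * c ^+ 2 by rewrite ler_wpM2l// mulr_ge0.
  have h6 : `|energy w u psi| <= c * (energy w u u / 2 + W).
    have c2 : 0 < 2 * c by rewrite mulr_gt0.
    rewrite -(ler_pM2l c2) (le_trans h4)//.
    rewrite (_ : 2 * c * (c * (energy w u u / 2 + W)) =
      c ^+ 2 * energy w u u + 2 * W * c ^+ 2); last by field.
    by rewrite lerD2l (le_trans h3).
  rewrite (le_trans (ler_normD _ _))// /K (mulrDr c _ 1) mulr1 lerD//.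
  by rewrite (le_trans h1)// expr2 ler_piMr// ltW.
apply/eqP/negPn/negP => n0; have p0 : 0 < `|dJ w h u phi| by rewrite normr_gt0.
pose c := Num.min 1 (`|dJ w h u phi| / (2 * K)).
have c0 : 0 < c by rewrite lt_min ltr01 divr_gt0// mulr_gt0.
have := main c c0; rewrite ge_min lexx => /(_ isT).
have : c * K <= `|dJ w h u phi| / (2 * K) * K.
  by rewrite ler_pM2r// ge_min lexx orbT.
have -> : `|dJ w h u phi| / (2 * K) * K = `|dJ w h u phi| / 2.
  by field; rewrite gt_eqF.
by lra.
Qed.

End criticality.

Theorem theorem1p2 (R : realType) (d : nat) (s : R)
    (w : Zd d -> Zd d -> R) (h : Zd d -> R) :
  (1 <= d)%N ->
  0 < s < 1 ->
  fractional_weight s w ->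
  potential_bounded_below h ->
  potential_coercive h ->
  exists u : Zd d -> R,
    [/\ weak_solution w h u, sign_changing u & J w h u = ground_level w h].
Proof.
move=> d1 /andP[s0 _] wP [h0 /andP[h0_gt _] h0_le] [x0 hc].
have [W hw] := fractional_weight_bounded d1 s0 wP.
have h_ge x : h0 <= h x.
  by rewrite -lee_fin (le_trans h0_le)//; apply: ereal_inf_lbound; exists x.
have h_coercive A : exists r : seq (Zd d), forall x, h x < A -> x \in r.
  have [K hK] := hc A; have [r hr] := ball_finite x0 K.
  exists r => x hx; apply: hr; rewrite ltnNge; apply/negP => /hK.
  by rewrite leNgt hx.
pose x1 : Zd d := [ffun=> 0]; pose x2 : Zd d := [ffun=> 1].
have x12 : x1 != x2.
  by apply/eqP => /ffunP/(_ (Ordinal d1)); rewrite !ffunE.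
have [u [nu Ju]] := nehari_minimizer hw h0_gt h_ge h_coercive x12.
have [Du su _ _] := nu; have au := (DJP hw h0_gt h_ge u).1 Du.
exists u; split=> //; split=> // phi /(DJP hw h0_gt h_ge) sphi.
apply: (critical_of_delta hw h0_gt h_ge au) sphi => x.
exact: (minimizer_critical_delta hw h0_gt h_ge).
Qed.
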